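(* The quadratic risk of the combined estimator $\hat E_\gamma$ is uniformly bounded over all $p\in\mathcal{P}_K$ as follows. 1) If $\gamma\in(0,1)$: $$\sup_{p\in\mathcal{P}_K}\mathbb{E}\left[(\hat E_\gamma-F_\gamma)^2\right]\lesssim_\gamma K^{2(1-\gamma)}\wedge\frac{K^2}{(\alpha^2n)^\gamma}.$$ 2) If $\gamma\in(1,3/2)$: $$\sup_{p\in\mathcal{P}_K}\mathbb{E}\left[(\hat E_\gamma-F_\gamma)^2\right]\lesssim_\gamma\frac{1}{(\alpha^2n)^{\gamma-1}}\wedge\left(\frac{K^2}{(\alpha^2n)^\gamma}+\frac{K^{3-2\gamma}}{\alpha^2n}\right).$$ 3) If $\gamma\in(3/2,2)$: $$\sup_{p\in\mathcal{P}_K}\mathbb{E}\left[(\hat E_\gamma-F_\gamma)^2\right]\lesssim_\gamma\frac{1}{(\alpha^2n)^{\gamma-1}}\wedge\left(\frac{K^2}{(\alpha^2n)^\gamma}+\frac{1}{\alpha^2n}\right).$$ 4) If $\gamma\ge2$: $$\sup_{p\in\mathcal{P}_K}\mathbb{E}\left[(\hat E_\gamma-F_\gamma)^2\right]\lesssim_\gamma\frac{1}{\alpha^2n}.$$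
   Context: $K,n$ are positive integers, $[K]=\{1,\dots,K\}$, and the privacy level $\alpha\in(0,1)$ satisfies $\alpha^2 n\ge 1$. $\mathcal{P}_K=\{p\in[0,1]^K:\sum_{k=1}^K p_k=1\}$, and $F_\gamma=F_\gamma(p)=\sum_{k=1}^K p_k^\gamma$. Sensitive data are i.i.d. with $\mathbb{P}(x=k)=p_k$, $k\in[K]$. The Laplace non-interactive privacy mechanism applied to a datum $x_i$ releases $z_i=(z_{i1},\dots,z_{iK})$ with $z_{ik}=\mathbf{1}_{\{x_i=k\}}+\frac{\sigma}{\alpha}w_{ik}$, where $\sigma=2$ and the $w_{ik}$ are i.i.d. with density $\frac12e^{-|x|}$, independent of the data. $T_{[0,2]}[y]=(y\vee0)\wedge2$. $\tau=c/\sqrt{\alpha^2n}$ with $c\ge1$ a fixed numerical constant. Plug-in estimator: from $n$ data privatized by the Laplace mechanism, $\hat F_\gamma=\sum_{k=1}^K(T_{[0,2]}[\hat z_k])^\gamma$ with $\hat z_k=\frac1n\sum_{i=1}^nz_{ik}$. Thresholded estimator for $\gamma\in(0,1)$: $\overline F_\gamma=\mathbf{1}_{\{K\le\tau^{-1}\}}\hat F_\gamma$. Two-step sequentially interactive estimator for $\gamma>1$ (sample size taken to be $2n$ for convenience, split as $x^{(1)},x^{(2)}$ of size $n$ each): $x^{(1)}$ is privatized by the Laplace mechanism into $z^{(1)}_{ik}$; $\hat z^{(1)}_k=\frac1n\sum_{i=1}^n z^{(1)}_{ik}$ and $\hat F^{(1)}_{\gamma-1}(k)=(T_{[0,2]}[\hat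 z^{(1)}_k])^{\gamma-1}$; with $z_\alpha=2^{\gamma-1}\frac{e^\alpha+1}{e^\alpha-1}$, each $i=1,\dots,n$ releases, independently of the others conditionally on $z^{(1)},x^{(2)}$, $z^{(2)}_i=\pm z_\alpha$ with probability $\frac12\left(1\pm\frac{1}{z_\alpha}\hat F^{(1)}_{\gamma-1}(x^{(2)}_i)\right)$; and $\widetilde F_\gamma=\frac1n\sum_{i=1}^nz^{(2)}_i$. Combined estimator: if $K\le\sqrt{\alpha^2n}$, $\hat E_\gamma=\hat F_\gamma$; if $K>\sqrt{\alpha^2n}$, $\hat E_\gamma=\overline F_\gamma$ for $\gamma<1$ and $\hat E_\gamma=\widetilde F_\gamma$ for $\gamma>1$. $x\wedge y=\min\{x,y\}$, $x\vee y=\max\{x,y\}$; $x\lesssim_\gamma y$ means $x\le C_\gamma y$ for some constant $C_\gamma$ depending only on $\gamma$. *)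

(* Defs.v *)
From HB Require Import structures.
From mathcomp Require Import all_boot all_order all_algebra.
From mathcomp Require Import all_classical all_reals all_analysis.

Set Implicit Arguments.
Unset Strict Implicit.
Unset Printing Implicit Defensive.

Import Order.TTheory GRing.Theory Num.Theory.
Import numFieldNormedType.Exports.

Local Open Scope classical_set_scope.
Local Open Scope ring_scope.

(** Throughout, categories 1, ..., K are the elements of ['I_K]. *)

Section parameters.
Context {R : realType}.

Definition prob_simplex (K : nat) : set ('I_K -> R) :=
  [set p | (forall k, 0 <= p k <= 1) /\ \sum_(k < K) p k = 1].

Definition power_sum (K : nat) (gamma : R) (p : 'I_K -> R) : R :=
  \sum_(k < K) p k `^ gamma.

Definition laplace_pdf (x : R) : R := expR (- `|x|) / 2.

End parameters.

Section probability_notions.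
Context d (T : measurableType d) (R : realType) (P : probability T R).

Definition mutually_independent (I : finType) (F : I -> set (set T)) : Prop :=
  forall (J : {set I}) (A : I -> set T), (forall i, i \in J -> F i (A i)) ->
    P (\bigcap_(i in [set` J]) A i) = (\prod_(i in J) P (A i))%E.

(* Any function into the finite type ['I_K], which carries the discrete
   sigma-algebra: measurability amounts to that of the fibres. *)
Definition categorical_law (K : nat) (X : T -> 'I_K) (p : 'I_K -> R) : Prop :=
  forall k, measurable (X @^-1` [set k]) /\ P (X @^-1` [set k]) = (p k)%:E.

Definition laplace_law (W : T -> R) : Prop :=
  forall B : set R, measurable B ->
    P (W @^-1` B) = (\int[lebesgue_measure]_(x in B) (laplace_pdf x)%:E)%E.

Definition sigma_cat (K : nat) (X : T -> 'I_K) : set (set T) :=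
  preimage_set_system setT X discrete_measurable.

Definition sigma_real (Y : T -> R) : set (set T) :=
  preimage_set_system setT Y measurable.

End probability_notions.

Section estimators.
Context {R : realType} {K n : nat}.
Implicit Types (alpha gamma c : R) (z : 'I_n -> 'I_K -> R).

Definition laplace_release alpha (x : 'I_K) (w : 'I_K -> R) (k : 'I_K) : R :=
  (x == k)%:R + 2 / alpha * w k.

Definition trunc02 (y : R) : R := Num.min (Num.max y 0) 2.

Definition zhat z (k : 'I_K) : R := n%:R^-1 * \sum_(i < n) z i k.

Definition plugin gamma z : R := \sum_(k < K) trunc02 (zhat z k) `^ gamma.

Definition tau c alpha : R := c / Num.sqrt (alpha ^+ 2 * n%:R).

Definition thresholded c alpha gamma z : R :=
  if K%:R <= (tau c alpha)^-1 then plugin gamma z else 0.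

Definition first_step gamma z (k : 'I_K) : R :=
  trunc02 (zhat z k) `^ (gamma - 1).

Definition z_level alpha gamma : R :=
  2 `^ (gamma - 1) * ((expR alpha + 1) / (expR alpha - 1)).

(* The probability that an individual with datum [x] releases
   [(-1) ^+ s * z_level alpha gamma], given the first-step data [z]. *)
Definition release_prob alpha gamma z (x : 'I_K) (s : bool) : R :=
  (1 + (-1) ^+ s * (first_step gamma z x / z_level alpha gamma)) / 2.

Definition two_step (z2 : 'I_n -> R) : R := n%:R^-1 * \sum_(i < n) z2 i.

(* The value at [gamma = 1] is irrelevant. *)
Definition combined c alpha gamma z (z2 : 'I_n -> R) : R :=
  if K%:R <= Num.sqrt (alpha ^+ 2 * n%:R) then plugin gamma z
  else if gamma < 1 then thresholded c alpha gamma z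
  else two_step z2.

End estimators.

(* Two samples [X1], [X2] of size n, the Laplace noise [W] used to privatize
   the first one, and the second-step releases [Z2]. *)
Record experiment (R : realType) (K n : nat) (alpha gamma : R)
    (p : 'I_K -> R) d (T : measurableType d) (P : probability T R) :=
  Experiment {
  X1 : 'I_n -> T -> 'I_K ;
  X2 : 'I_n -> T -> 'I_K ;
  W : 'I_n -> 'I_K -> {RV P >-> R} ;
  Z2 : 'I_n -> {RV P >-> R} ;
  Z1 : 'I_n -> 'I_K -> T -> R :=
    fun i k w => laplace_release alpha (X1 i w) (fun l => W i l w) k ;
  X1_law : forall i, categorical_law P (X1 i) p ;
  X2_law : forall i, categorical_law P (X2 i) p ;
  W_law : forall i k, laplace_law P (W i k) ;
  X1_X2_W_independent :
    mutually_independent P (fun j : 'I_n + 'I_n + 'I_n * 'I_K =>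
      match j with
      | inl (inl i) => sigma_cat (X1 i)
      | inl (inr i) => sigma_cat (X2 i)
      | inr (i, k) => sigma_real (W i k)
      end) ;
  (* The joint conditional law of [Z2] given sigma(Z1, X2), tested against the
     events [A] of this sigma-algebra.  For [gamma < 1] there is no second step
     ([release_prob] need not even lie in [0, 1]), so nothing is required. *)
  Z2_conditional_law : 1 < gamma ->
    forall (A : set T) (s : 'I_n -> bool),
    <<s \bigcup_ik sigma_real (Z1 ik.1 ik.2) `|`
        \bigcup_i sigma_cat (X2 i) >> A ->
    P (A `&` [set w | forall i, Z2 i w = (-1) ^+ s i * z_level alpha gamma]) =
    (\int[P]_(w in A) (\prod_(i < n)
       release_prob alpha gamma (fun j k => Z1 j k w) (X2 i w) (s i))%:E)%E }.

Section risk.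
Context {R : realType}.
Variables (K n : nat) (alpha gamma c : R).

Definition quadratic_risk (p : 'I_K -> R) d (T : measurableType d)
    (P : probability T R) (E : experiment n alpha gamma p P) : \bar R :=
  ('E_P[fun w => ((combined c alpha gamma (fun i k => Z1 E i k w)
                     (fun i => Z2 E i w) - power_sum gamma p) ^+ 2)%R])%E.

(* The risk depends only on the law of the experiment, i.e. on [p]; the sup
   also ranges over all realizations of that law. *)
Definition sup_risk : \bar R :=
  ereal_sup [set r | exists2 p : 'I_K -> R, prob_simplex p &
    exists (d : measure_display) (T : measurableType d) (P : probability T R)
      (E : experiment n alpha gamma p P), r = quadratic_risk E].

End risk.

(* The constant [C] depends on [gamma] only. *)
Definition sup_risk_lesssim {R : realType} (gamma : R)
    (rate : nat -> nat -> R -> R) : Prop :=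
  exists C : R, forall (K n : nat) (alpha c : R),
    (0 < K)%N -> (0 < n)%N -> 0 < alpha < 1 -> 1 <= alpha ^+ 2 * n%:R ->
    1 <= c ->
    (sup_risk K n alpha gamma c <= (C * rate K n alpha)%:E)%E.

(* Main.v *)
Require Import Defs.
From mathcomp Require Import all_boot all_order all_algebra.
From mathcomp Require Import all_classical all_reals all_analysis.
From mathcomp Require Import measurable_realfun zify ring lra.

Import Order.TTheory GRing.Theory Num.Theory.
Import numFieldNormedType.Exports.
Local Open Scope ring_scope.

(** Write [m = alpha ^+ 2 * n] and [delta_k] for the deviation of the private
frequency of category [k] from [p k].  Linear combinations of the [delta_k] are
sums of independent centered variables, whose second and fourth moments are of
order [m^-1] and [m^-2].

If [K ^+ 2 <= m], a pathwise Taylor expansion of order one bounds the error of the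
plug-in estimator by its linear part plus [sum_k |delta_k|^(min gamma 2)] (for
[gamma < 1], by [sum_k |delta_k|^gamma] directly).  Fractional moments are reduced
to integer ones by the tangent inequality [x^s <= t^s + t^(s-1) x] at [t = m^-1] or
[t = m^-2].

If [K ^+ 2 > m] and [gamma < 1], the estimator is [0] and
[power_sum gamma p <= K^(1-gamma)].  If [gamma > 1], the risk of the two-step
estimator is a conditional variance of order [m^-1], plus the mean square of
[n^-1 sum_i f (x_i) - power_sum gamma p] where [f] estimates [p k ^(gamma-1)]; the
latter reduces to the moments of the [delta_k] weighted by [x_i == k], which is
independent of them. *)

Set Implicit Arguments.
Unset Strict Implicit.
Unset Printing Implicit Defensive.

(** * Power inequalities *)

(** The estimator switches at [K ^+ 2 = m], which is also where the members of each minimum cross,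
    up to a factor 2; so each regime needs a single risk bound, followed by a comparison of rates.
    For [gamma > 1] the linear part has to stay one sum over [k]: its mean square is then of order
    [(1 + sum_k (p k)^(2(gamma-1))) / m], free of any factor [K], whereas the remainders go through
    Cauchy-Schwarz, which produces [K ^+ 2]. Squared remainders are of size
    [|delta_k|^(2 min gamma 2)], an exponent that reaches 4, whence the fourth moments; for
    [gamma < 1] the exponent [2 gamma] stays below 2 and second moments suffice. In the two-step
    estimator no [K] appears, because the weights [x_i == k] have means [p k], which sum to 1.
    Independence is available only as a product formula for events, so the factorization of means is
    derived from it before any moment is computed. *)

Lemma eq_ler (R : numDomainType) (x y : R) : x = y -> x <= y.
Proof. by move=> ->. Qed.

Section powR_inequalities.
Context {R : realType}.
Implicit Types a b g s t x y p : R.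

(** At [x = 0] both sides vanish, since [0] to a nonzero power is [0] even when the exponent is
    negative; the identity therefore covers categories of probability zero. *)
Lemma powRS x s : 0 <= x -> s != 0 -> x `^ s = x * x `^ (s - 1).
Proof.
rewrite le_eqVlt => /predU1P[<- s0|x0 s0]; first by rewrite mul0r powR0.
by rewrite powRB ?(gt_eqF x0) ?implybT// powRr1 ?ltW// mulrCA divff ?mulr1// gt_eqF.
Qed.

(** Concavity: the right-hand side is the tangent at [t]. It comes from Young's inequality for
    [x ^ s] and [t ^ (1 - s)] with exponents [1/s] and [1/(1 - s)], multiplied by [t ^ (s - 1)]. *)
Lemma powR_le_tangent s t x : 0 < s <= 1 -> 0 < t -> 0 <= x ->
  x `^ s <= s * t `^ (s - 1) * x + (1 - s) * t `^ s.
Proof.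
move=> /andP[s0 s1] t0 x0; move: s1; rewrite le_eqVlt => /predU1P[->|s1].
  by rewrite subrr powRr0 powRr1// mul0r addr0 !mul1r.
have s1' : 0 < 1 - s by lra.
have := @conjugate_powR R (x `^ s) (t `^ (1 - s)) (s^-1) ((1 - s)^-1)
  (powR_ge0 _ _) (powR_ge0 _ _).
rewrite !invr_gt0 !invrK => /(_ s0 s1' (subrKC _ _)).
rewrite -!powRrM !divff ?gt_eqF// !powRr1// ?(ltW t0)// => H.
have ts : 0 <= t `^ (s - 1) by exact: powR_ge0.
have := ler_wpM2l ts H.
rewrite mulrCA -powRD ?(gt_eqF t0) ?implybT// addrC subrKA subrr powRr0 mulr1.
move=> /le_trans; apply.
by rewrite (@powRS t s) ?(ltW t0) ?(gt_eqF s0)//; apply: eq_ler; ring.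
Qed.

(** Convexity: this is [y ^ g + g y ^ (g - 1) (x - y) <= x ^ g] rearranged, and follows from Young's
    inequality for [x] and [y ^ (g - 1)] with exponents [g] and [g / (g - 1)]. *)
Lemma tangent_le_powR g x y : 1 <= g -> 0 <= x -> 0 <= y ->
  g * y `^ (g - 1) * x <= x `^ g + (g - 1) * y `^ g.
Proof.
rewrite le_eqVlt => /predU1P[<-|g1] x0 y0.
  by rewrite subrr powRr0 powRr1// mul0r addr0 !mul1r.
have g0 : 0 < g by lra.
have g1' : 0 < g - 1 by lra.
have := @conjugate_powR R x (y `^ (g - 1)) g (g / (g - 1)) x0
  (powR_ge0 _ _) g0 (divr_gt0 g0 g1').
have -> : g^-1 + (g / (g - 1))^-1 = 1 by field; rewrite !gt_eqF.
move=> /(_ erefl).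
have e : (g - 1) * (g / (g - 1)) = g by field; rewrite gt_eqF.
rewrite -powRrM e.
rewrite -(ler_pM2l g0) => /le_trans H.
rewrite mulrAC -mulrA H//; apply: eq_ler;  field; rewrite !gt_eqF//.
Qed.

Lemma ge0_powR_le1 x s : 0 <= x <= 1 -> 0 < s <= 1 -> x <= x `^ s.
Proof.
move=> /andP[]; rewrite le_eqVlt => /predU1P[<-|x0] x1 /andP[s0 s1].
  by rewrite powR_ge0.
by apply: ger1_powR => //; rewrite x0.
Qed.

Lemma powR_le_id x s : 0 <= x <= 1 -> 1 <= s -> x `^ s <= x.
Proof.
move=> /andP[]; rewrite le_eqVlt => /predU1P[<-|x0] x1 s1.
  by rewrite powR0// gt_eqF//; lra.
by apply: ge1r_powR => //; rewrite x0.
Qed.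

Lemma powR_subadditive s x y : 0 < s <= 1 -> 0 <= x -> 0 <= y ->
  (x + y) `^ s <= x `^ s + y `^ s.
Proof.
move=> s01 x0 y0; have := addr_ge0 x0 y0.
rewrite le_eqVlt => /predU1P[<-|xy0].
  rewrite powR0; last by apply/negP => /eqP s0; move: s01; rewrite s0 ltxx.
  by rewrite addr_ge0 ?powR_ge0.
(* A fraction in [[0, 1]] increases when raised to a power at most 1; the two fractions of [x + y]
   add up to 1. *)
have frac z : 0 <= z -> z <= x + y -> z / (x + y) * (x + y) `^ s <= z `^ s.
  move=> z0 zxy; have zq : 0 <= z / (x + y) by rewrite divr_ge0// ltW.
  rewrite -{2}(divfK (lt0r_neq0 xy0) z) powRM ?(ltW xy0)// ler_wpM2r ?powR_ge0//.
  by rewrite ge0_powR_le1// zq ler_pdivrMr// mul1r.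
have := lerD (frac x x0 ltac:(lra)) (frac y y0 ltac:(lra)).
by rewrite -mulrDl -mulrDl divff ?mul1r// gt_eqF.
Qed.

Lemma powR_holder s a b : 0 < s <= 1 -> 0 <= a -> 0 <= b ->
  `|a `^ s - b `^ s| <= `|a - b| `^ s.
Proof.
move=> s01; have s0 : 0 <= s by case/andP: s01 => /ltW.
wlog ba : a b / b <= a => [H a0 b0|a0 b0].
  by case: (leP b a) => [/H|/ltW/H]; [apply|rewrite distrC (distrC a); apply].
rewrite ger0_norm ?subr_ge0 ?ge0_ler_powR ?nnegrE//.
rewrite ger0_norm ?subr_ge0// lerBlDr.
by rewrite -{1}(subrK b a) powR_subadditive// subr_ge0.
Qed.

(** The tangent at the larger point bounds the increment, and the slope there is at most its value
    at 2. *)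
Lemma powR_lipschitz s a b : 1 <= s -> 0 <= a <= 2 -> 0 <= b <= 2 ->
  `|a `^ s - b `^ s| <= s * 2 `^ (s - 1) * `|a - b|.
Proof.
move=> s1; wlog ba : a b / b <= a => [H a0 b0|/andP[a0 a2] /andP[b0 b2]].
  by case: (leP b a) => [/H|/ltW/H]; [apply|rewrite distrC (distrC a); apply].
have s0 : s != 0 by rewrite gt_eqF//; lra.
rewrite ger0_norm ?subr_ge0 ?ge0_ler_powR ?nnegrE//; last by lra.
rewrite ger0_norm ?subr_ge0//.
have H := tangent_le_powR s1 b0 a0; have H2 := powRS a0 s0.
apply: (@le_trans _ _ (s * a `^ (s - 1) * (a - b))).
  move: (a `^ s) (a `^ (s - 1)) (b `^ s) H H2 => u v w H uE.
  have : s * v * a = s * u by rewrite uE mulrA mulrAC.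
  lra.
rewrite ler_wpM2r ?subr_ge0// ler_wpM2l//; first by lra.
by rewrite ge0_ler_powR ?nnegrE//; lra.
Qed.

Lemma powR_min_holder s : 0 < s -> exists2 C : R, 0 <= C &
  forall a b, 0 <= a <= 2 -> 0 <= b <= 2 ->
    `|a `^ s - b `^ s| <= C * `|a - b| `^ Num.min s 1.
Proof.
move=> s0; case: (leP s 1) => s1.
  exists 1 => // a b /andP[a0 _] /andP[b0 _].
  by rewrite mul1r powR_holder// s0.
exists (s * 2 `^ (s - 1)) => [|a b a02 b02]; first by rewrite mulr_ge0 ?powR_ge0 ?ltW.
by rewrite powRr1// powR_lipschitz// ltW.
Qed.

(** A substitute for Jensen's inequality: if [x] has mean at most [C t], then [x ^ s] has mean at
    most [(1 + C) t ^ s]. *)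
Lemma powR_interpolation s t x : 0 < s <= 1 -> 0 < t -> 0 <= x ->
  x `^ s <= t `^ s + t `^ (s - 1) * x.
Proof.
move=> s01 t0 x0; apply: le_trans (powR_le_tangent s01 t0 x0) _.
case/andP: s01 => s0 s1; rewrite addrC lerD//.
  by rewrite ler_piMl ?powR_ge0//; lra.
by rewrite -mulrA ler_piMl// mulr_ge0 ?powR_ge0.
Qed.

Lemma sqr_powR x s : 0 <= x -> (x `^ s) ^+ 2 = (x ^+ 2) `^ s.
Proof. by move=> x0; rewrite !expr2 powRM. Qed.

Lemma powRDr1 x s : 0 <= x -> 0 < s -> x `^ (s + 1) = x `^ s * x.
Proof. by move=> x0 s0; rewrite powRS ?addrK 1?mulrC// gt_eqF//; lra. Qed.

Lemma trunc02P y : [\/ y <= 0 /\ trunc02 y = 0, 0 <= y <= 2 /\ trunc02 y = y |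
  2 <= y /\ trunc02 y = 2].
Proof.
rewrite /trunc02; case: (leP y 0) => [y0|/ltW y0].
  by apply: Or31; rewrite min_l.
by case: (leP y 2) => y2; [apply: Or32; rewrite y0|apply: Or33; rewrite ltW].
Qed.

Lemma trunc02_bounds y : 0 <= trunc02 y <= 2.
Proof. by case: (trunc02P y) => -[? ->]; lra. Qed.

Lemma trunc02_contracts p y : 0 <= p <= 1 -> `|trunc02 y - p| <= `|y - p|.
Proof.
move=> p01; have := ler_norm (y - p); have := ler_norm (- (y - p)).
by rewrite normrN ler_norml => ? ?; case: (trunc02P y) => -[? ->]; lra.
Qed.

(** Truncation moves [y] only if [y < 0], where [|y - p| >= p], or if [y > 2], where
    [|y - p| >= 1 >= p]. It never moves [y] farther than [p], which lies in [[0, 2]]. *)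
Lemma trunc02_far p y : 0 <= p <= 1 ->
  trunc02 y = y \/ p <= `|y - p| /\ `|trunc02 y - y| <= `|y - p|.
Proof.
move=> p01; have := ler_norm (y - p); have := ler_norm (- (y - p)).
rewrite normrN => ? ?; case: (trunc02P y) => -[? ->]; [right|by left|right];
  by rewrite ler_norml; split; lra.
Qed.

(** The tangents at [b] and at [a] place the remainder between [0] and
    [g (a ^ (g - 1) - b ^ (g - 1)) (a - b)]; the Hölder bound on the derivative concludes, without
    any second derivative, which would be unbounded near 0 for [g < 2]. *)
Lemma powR_taylor g : 1 < g -> exists2 C : R, 0 <= C & forall a b,
  0 <= a <= 2 -> 0 <= b <= 2 ->
  `|a `^ g - b `^ g - g * b `^ (g - 1) * (a - b)| <= C * `|a - b| `^ Num.min g 2.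
Proof.
move=> g1; have g1' : 0 < g - 1 by lra.
have [C C0 HC] := powR_min_holder g1'.
have -> : Num.min g 2 = Num.min (g - 1) 1 + 1.
  by rewrite [RHS]addrC addr_minr [1 + _]addrC subrK.
have m0 : 0 < Num.min (g - 1) 1 by rewrite lt_min g1' ltr01.
exists (g * C) => [|a b a02 b02]; first by rewrite mulr_ge0//; lra.
have [a0 b0] : 0 <= a /\ 0 <= b by lra.
have H1 := tangent_le_powR (ltW g1) a0 b0; have H2 := tangent_le_powR (ltW g1) b0 a0.
have g0 : g != 0 by rewrite gt_eqF//; lra.
have Ea := powRS a0 g0; have Eb := powRS b0 g0.
rewrite powRDr1// -[leRHS]mulrA.
apply: (@le_trans _ _ (g * `|(a `^ (g - 1) - b `^ (g - 1)) * (a - b)|)); last first.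
  rewrite ler_wpM2l//; first by lra.
  by rewrite normrM mulrA ler_wpM2r// HC.
move: (a `^ g) (b `^ g) (a `^ (g - 1)) (b `^ (g - 1)) H1 H2 Ea Eb => A B u v H1 H2 EA EB.
have Eau : g * u * a = g * A by rewrite EA; ring.
have Ebv : g * v * b = g * B by rewrite EB; ring.
have gp : 0 <= g by lra.
apply: (@le_trans _ _ (g * ((u - v) * (a - b)))); last first.
  by rewrite ler_wpM2l// ler_norm.
rewrite ger0_norm; lra.
Qed.

(* The linear term involves [y], not [trunc02 y], so that it is unbiased: the
   truncation only acts when [p <= `|y - p|] and is then of the remainder's order. *)
Lemma trunc02_powR_taylor g : 1 < g -> exists2 C : R, 0 <= C & forall p y,
  0 <= p <= 1 ->
  `|trunc02 y `^ g - p `^ g - g * p `^ (g - 1) * (y - p)|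
    <= C * `|y - p| `^ Num.min g 2.
Proof.
move=> g1; have g1' : 0 < g - 1 by lra.
have [C C0 HC] := powR_taylor g1; exists (C + g) => [|p y p01]; first by lra.
have p02 : 0 <= p <= 2 by lra.
have gp : 0 <= g by lra.
have := HC _ _ (trunc02_bounds y) p02; move: (trunc02_contracts y p01) => tc H.
have m0 : 0 <= Num.min g 2 by rewrite le_min gp /=.
have {}H := le_trans H (ler_wpM2l C0 (ge0_ler_powR m0 (normr_ge0 _) (normr_ge0 _) tc)).
have {}H' : `|g * p `^ (g - 1) * (trunc02 y - y)| <= g * `|y - p| `^ Num.min g 2.
  rewrite normrM ger0_norm ?mulr_ge0 ?powR_ge0// -mulrA ler_wpM2l//.
  have [->|[py ty]] := trunc02_far y p01; first by rewrite subrr normr0 mulr0 powR_ge0.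
  have -> : Num.min g 2 = Num.min (g - 1) 1 + 1.
    by rewrite [RHS]addrC addr_minr [1 + _]addrC subrK.
  have k0 : 0 < Num.min (g - 1) 1 by rewrite lt_min g1' ltr01.
  rewrite powRDr1// ler_pM ?powR_ge0//.
  apply: (@le_trans _ _ (p `^ Num.min (g - 1) 1)); last first.
    by apply: ge0_ler_powR; rewrite ?nnegrE ?(ltW k0)//; lra.
  case/andP: p01; rewrite le_eqVlt => /predU1P[<- _|p0 p1].
    by rewrite !powR0// gt_eqF.
  by apply: ger_powR; rewrite ?p0// ge_min lexx.
rewrite mulrDl.
rewrite [X in `|X|](_ : _ = (trunc02 y `^ g - p `^ g - g * p `^ (g - 1) * (trunc02 y - p))
   + g * p `^ (g - 1) * (trunc02 y - y)); last by ring.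
by rewrite (le_trans (ler_normD _ _))// lerD.
Qed.

End powR_inequalities.

(** * Cauchy-Schwarz and power sums over the simplex *)

Section finite_sums.
Context {R : realType}.

(** The sum of the squared deviations from the average is nonnegative. *)
Lemma sqr_sum_le (I : finType) (a : I -> R) :
  (\sum_i a i) ^+ 2 <= #|I|%:R * \sum_i a i ^+ 2.
Proof.
have [I0|I0] := posnP #|I|.
  rewrite big1 ?expr0n/= ?mulr_ge0 ?sumr_ge0// => i _; first exact: sqr_ge0.
  by have := fintype0 i I0.
set S := \sum_i a i; set N : R := #|I|%:R.
have N0 : 0 < N by rewrite ltr0n.
have : 0 <= \sum_i (a i - S / N) ^+ 2 by apply: sumr_ge0 => i _; exact: sqr_ge0.
have -> : \sum_i (a i - S / N) ^+ 2 = \sum_i a i ^+ 2 - S ^+ 2 / N.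
  rewrite (eq_bigr (fun i => a i ^+ 2 + (- 2 * (S / N) * a i + (S / N) ^+ 2)))
    => [|i _]; last by ring.
  rewrite !big_split/= -mulr_sumr -/S sumr_const -[_ *+ _]mulr_natr -/N.
  by field; rewrite gt_eqF.
by rewrite subr_ge0 ler_pdivrMr// mulrC.
Qed.

(** The uniform distribution is extremal, so the tangent is taken at [1/K]; its linear part sums to
    a constant because the [p k] sum to 1. *)
Lemma prob_simplex_sum_powR (K : nat) (p : 'I_K -> R) (s : R) : (0 < K)%N ->
  prob_simplex p -> 0 < s <= 1 -> \sum_k p k `^ s <= K%:R `^ (1 - s).
Proof.
move=> K0 [p01 p1] s01.
have k0 : 0 < K%:R :> R by rewrite ltr0n.
have H k : p k `^ s <= s * K%:R^-1 `^ (s - 1) * p k + (1 - s) * K%:R^-1 `^ s.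
  by apply: powR_le_tangent; rewrite ?invr_gt0//; case/andP: (p01 k).
apply: le_trans (ler_sum _ (fun k _ => H k)) _.
rewrite big_split/= -mulr_sumr p1 mulr1 sumr_const card_ord -[X in _ + X]mulr_natr.
rewrite (@powRS _ _ s) ?invr_ge0 ?(ltW k0)//; last by case/andP: s01 => /lt0r_neq0.
rewrite -(powR_inv1 (ltW k0)) -powRrM mulN1r opprB.
set u := _ `^ (1 - s); rewrite powR_inv1 ?(ltW k0)//; apply: eq_ler.
by field; rewrite gt_eqF.
Qed.

Lemma prob_simplex_sum_powR_le1 (K : nat) (p : 'I_K -> R) (s : R) :
  prob_simplex p -> 1 <= s -> \sum_k p k `^ s <= 1.
Proof.
move=> [p01 p1] s1; rewrite -[leRHS]p1; apply: ler_sum => k _; exact: powR_le_id.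
Qed.

End finite_sums.

(** * Transfer along equal densities *)

Section density_transfer.
Local Open Scope ereal_scope.
Local Open Scope classical_set_scope.
Context {R : realType} d1 (T1 : measurableType d1) d2 (T2 : measurableType d2).
Variables (m1 : {measure set T1 -> \bar R}) (m2 : {measure set T2 -> \bar R}).
Variables (V1 : T1 -> R) (V2 : T2 -> R) (H : T2 -> R) (c : R).
Hypotheses (mV1 : measurable_fun setT V1) (mV2 : measurable_fun setT V2).
Hypotheses (mH : measurable_fun setT H) (H0 : forall x, (0 <= H x)%R).
Hypothesis V12 : forall B : set R, measurable B ->
  m1 (V1 @^-1` B) * c%:E = \int[m2]_(x in V2 @^-1` B) (H x)%:E.

Import HBNNSimple.

Let density_transfer_nnsfun (h : {nnsfun R >-> R}) :
  (\int[m1]_x (h (V1 x))%:E) * c%:E = \int[m2]_x ((h (V2 x))%:E * (H x)%:E).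
Proof.
have mh r : measurable (h @^-1` [set r]).
  by rewrite -[X in measurable X]setTI; apply: measurable_funP.
have mV d (T : measurableType d) (V : T -> R) r : measurable_fun setT V ->
    measurable (V @^-1` (h @^-1` [set r])).
  by move=> mV; rewrite -[X in measurable X]setTI; exact: mV.
have mI d (T : measurableType d) (V : T -> R) r : measurable_fun setT V ->
    measurable_fun setT (fun x => (r * \1_(h @^-1` [set r]) (V x))%:E).
  move=> mfV; apply/measurable_EFinP; apply: measurable_funM => //.
  exact: (measurableT_comp _ mfV).
under eq_integral do rewrite fimfunE -fsumEFin//.
rewrite ge0_integral_fsum//; last 2 first.
- by move=> r; exact: mI.
- by move=> r x _; rewrite nnfun_muleindic_ge0.
under [RHS]eq_integral => x _.
  rewrite fimfunE -fsumEFin// ge0_mule_fsuml; last first.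
    by move=> r; rewrite nnfun_muleindic_ge0.
  over.
rewrite /= ge0_integral_fsum//; last 2 first.
- by move=> r; apply: emeasurable_funM; [|exact/measurable_EFinP]; exact: mI.
- by move=> r x _; apply: mule_ge0; [exact: nnfun_muleindic_ge0|rewrite lee_fin].
rewrite ge0_mule_fsuml; last first.
  by move=> r; apply: integral_ge0 => x _; rewrite nnfun_muleindic_ge0.
apply: eq_fsbigr => r /[!inE] -[y _ hy].
have r0 : (0 <= r)%R by rewrite -hy.
under eq_integral do rewrite EFinM.
rewrite ge0_integralZl//; last first.
  by apply/measurable_EFinP; exact: (measurableT_comp _ mV1).
under [RHS]eq_integral do rewrite EFinM -muleA.
rewrite ge0_integralZl//; last 2 first.
- apply: emeasurable_funM; [|exact/measurable_EFinP].
  by apply/measurable_EFinP; exact: (measurableT_comp _ mV2).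
- by move=> x _; rewrite mule_ge0// lee_fin.
rewrite -muleA; congr (_ * _).
rewrite (_ : \int[m1]_x _ = m1 (V1 @^-1` (h @^-1` [set r]))); last first.
  rewrite -[X in m1 X]setIT -integral_indic//; last exact: mV.
rewrite V12//.
rewrite [LHS]integral_mkcond; apply: eq_integral => x _.
rewrite patchE; case: ifPn => /= [/[!inE] xr|xr].
  by rewrite indicE mem_set ?mul1e//.
by rewrite indicE (_ : _ \in _ = false) ?mul0e//; apply/negbTE.
Qed.

(** The hypothesis is the case where [g] is an indicator; simple functions follow by linearity and
    nonnegative ones by monotone convergence. It serves two purposes: with [H] a product of other
    factors and [c] its mean it factorizes an expectation, and with [H] the Laplace density it
    computes integrals of a Laplace variable. *)
Lemma density_transfer (g : R -> R) : measurable_fun setT g ->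
  (forall x, (0 <= g x)%R) ->
  (\int[m1]_x (g (V1 x))%:E) * c%:E = \int[m2]_x ((g (V2 x))%:E * (H x)%:E).
Proof.
move=> mg g0.
have mEg : measurable_fun setT (EFin \o g) by exact/measurable_EFinP.
pose g_ := nnsfun_approx measurableT mEg.
have cg x : (g_ n x)%:E @[n --> \oo] --> (g x)%:E.
  by apply: cvg_nnsfun_approx => // y _; rewrite lee_fin.
have nd x m n : (m <= n)%N -> (g_ m x)%:E <= (g_ n x)%:E.
  by move=> mn; rewrite lee_fin; exact/lefP/nd_nnsfun_approx.
have L : (\int[m1]_x (g_ n (V1 x))%:E) @[n --> \oo] --> \int[m1]_x (g (V1 x))%:E.
  rewrite [X in _ --> X](_ : _ = \int[m1]_x limn (fun n => (g_ n (V1 x))%:E)).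
    apply: (@cvg_monotone_convergence _ _ _ m1 setT measurableT
      (fun n x => (g_ n (V1 x))%:E)) => //.
    - by move=> n; apply/measurable_EFinP; exact: (measurableT_comp _ mV1).
    - by move=> n x _; rewrite lee_fin.
    - by move=> x _ m n mn; exact: nd.
  by apply: eq_integral => x _; apply/esym/cvg_lim.
have L2 : (\int[m2]_x ((g_ n (V2 x))%:E * (H x)%:E)) @[n --> \oo] -->
    \int[m2]_x ((g (V2 x))%:E * (H x)%:E).
  rewrite [X in _ --> X](_ : _ = \int[m2]_x limn (fun n => (g_ n (V2 x))%:E * (H x)%:E)).
    apply: (@cvg_monotone_convergence _ _ _ m2 setT measurableT
      (fun n x => (g_ n (V2 x))%:E * (H x)%:E)) => //.
    - move=> n; apply: emeasurable_funM; [|exact/measurable_EFinP].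
      by apply/measurable_EFinP; exact: (measurableT_comp _ mV2).
    - by move=> n x _; rewrite mule_ge0// lee_fin.
    - by move=> x _ m n mn; rewrite lee_wpmul2r ?lee_fin//; exact: nd.
  apply: eq_integral => x _; apply/esym/cvg_lim => //.
  exact: cvgeZr.
have cfin : c%:E \is a fin_num by [].
have L3 := cvgeZr cfin L.
rewrite (funext (fun n => density_transfer_nnsfun (g_ n))) in L3.
exact: cvg_unique L3 L2.
Qed.
End density_transfer.

(** * Means and products of independent variables *)

Section has_mean.
Local Open Scope classical_set_scope.
Context d (T : measurableType d) (R : realType) (P : probability T R).
Implicit Types (f g : T -> R) (e c : R).

(** Integrability is bundled with a real value, so that means combine by linearity and products
    without finiteness side conditions in the extended reals. *)
Definition has_mean f e : Prop :=
  P.-integrable setT (EFin \o f) /\ (\int[P]_x (f x)%:E = e%:E)%E.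

Lemma has_mean_measurable f e : has_mean f e -> measurable_fun setT f.
Proof. by move=> [/measurable_int/measurable_EFinP]. Qed.

Lemma has_mean_cst c : has_mean (fun=> c) c.
Proof.
split; first exact: finite_measure_integrable_cst.
by have := @expectation_cst _ _ _ P c; rewrite expectation.unlock.
Qed.

Lemma has_mean_eq f g e : f =1 g -> has_mean f e -> has_mean g e.
Proof. by move=> /funext ->. Qed.

Lemma has_meanZ c f e : has_mean f e -> has_mean (fun x => c * f x) (c * e).
Proof.
move=> [If Ef]; split; first exact: (integrableZl measurableT c If).
by under eq_integral do rewrite EFinM; rewrite integralZl//= Ef EFinM.
Qed.

Lemma has_mean_sum (I : finType) (f : I -> T -> R) (e : I -> R) :
  (forall i, has_mean (f i) (e i)) ->
  has_mean (fun x => \sum_i f i x) (\sum_i e i).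
Proof.
move=> fe; split.
  rewrite (_ : _ \o _ = (fun x => \sum_i (f i x)%:E)); last first.
    by apply/funext => x /=; rewrite sumEFin.
  by apply: integrable_sum => // i _; case: (fe i).
under eq_integral do rewrite -sumEFin.
rewrite integral_sum//; last by move=> i; case: (fe i).
by rewrite -sumEFin; apply: eq_bigr => i _; case: (fe i).
Qed.

Lemma has_meanD f g e e' : has_mean f e -> has_mean g e' ->
  has_mean (fun x => f x + g x) (e + e').
Proof.
move=> fe ge; have := @has_mean_sum bool (fun b => if b then f else g)
  (fun b => if b then e else e').
rewrite big_bool/= => H; apply: has_mean_eq (H _); last by case.
by move=> x; rewrite big_bool.
Qed.

Lemma has_mean_ge0 f e : measurable_fun setT f -> (forall x, 0 <= f x) ->
  (\int[P]_x (f x)%:E = e%:E)%E -> has_mean f e.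
Proof.
move=> mf f0 fe; split => //; apply/integrableP; split; first exact/measurable_EFinP.
by under eq_integral do rewrite /= ger0_norm//; rewrite fe ltry.
Qed.

Lemma has_mean_indic (A : set T) : measurable A -> has_mean \1_A (fine (P A)).
Proof.
move=> mA; apply: has_mean_ge0 => //.
by rewrite integral_indic// setIT fineK// fin_num_measure.
Qed.

Lemma has_mean_le f g e e' : has_mean f e -> has_mean g e' ->
  (forall x, f x <= g x) -> e <= e'.
Proof.
move=> [If fe] [Ig ge] fg; rewrite -lee_fin -fe -ge.
by apply: le_integral => // x _; rewrite lee_fin.
Qed.

Lemma has_mean_unique f e e' : has_mean f e -> has_mean f e' -> e = e'.
Proof. by move=> [_ fe] [_]; rewrite fe => -[]. Qed.

Lemma has_mean_dominated f g e : measurable_fun setT f ->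
  (forall x, `|f x| <= g x) -> has_mean g e -> exists e', has_mean f e'.
Proof.
move=> mf fg [Ig ge].
have If : P.-integrable setT (EFin \o f).
  apply: le_integrable Ig => //; first exact/measurable_EFinP.
  by move=> x _ /=; rewrite lee_fin (le_trans (fg x))// ler_norm.
exists (fine (\int[P]_x (f x)%:E)); split => //.
by rewrite fineK//; exact: integrable_fin_num.
Qed.

Lemma has_mean_normr f e : has_mean f e -> exists e', has_mean (fun x => `|f x|) e'.
Proof.
move=> fe; have mf := has_mean_measurable fe; case: fe => If _.
exists (fine (\int[P]_x (`|f x|)%:E)); split; first exact: integrable_abse If.
by rewrite fineK//; apply: integrable_fin_num => //; exact: integrable_abse If.
Qed.

Lemma has_mean_bounded f c : measurable_fun setT f -> (forall x, `|f x| <= c) ->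
  exists e, has_mean f e.
Proof. by move=> mf fc; apply: has_mean_dominated mf fc (has_mean_cst c). Qed.

End has_mean.

Section independent_products.
Local Open Scope classical_set_scope.
Context d (T : measurableType d) (R : realType) (P : probability T R).

(** Measurability with respect to [G], phrased with preimages because [G] is a bare family of sets
    on a space that already carries another measurable structure. *)
Definition generated_by (G : set (set T)) (f : T -> R) : Prop :=
  forall B : set R, measurable B -> G (f @^-1` B).

Lemma generated_by_comp (G : set (set T)) (f : T -> R) (g : R -> R) :
  measurable_fun setT g -> generated_by G f -> generated_by G (g \o f).
Proof.
move=> mg Gf B mB; rewrite comp_preimage; apply: Gf.
by rewrite -[X in measurable X]setTI; exact: mg.
Qed.

Context (I : finType) (F : I -> set (set T)).
Hypothesis Fm : forall i, F i `<=` measurable.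
Hypothesis Find : mutually_independent P F.

Let mean_prod_seq (r : seq I) : uniq r -> forall (f : I -> T -> R) (e : I -> R),
  (forall i x, 0 <= f i x) ->
  (forall i, i \in r -> generated_by (F i) (f i)) ->
  (forall i, i \notin r -> exists2 A, F i A & f i = \1_A) ->
  (forall i, has_mean P (f i) (e i)) ->
  has_mean P (fun x => \prod_i f i x) (\prod_i e i).
Proof.
elim: r => [_|i r IH /= /andP[ir ur]] f e f0 fr fnr fe.
  have /choice[A AP] : forall i, exists A, F i A /\ f i = \1_A.
    by move=> i; have [|A FA fA] := fnr i; [rewrite in_nil|exists A].
  have prodA x : \prod_i f i x = \1_(\bigcap_(i in [set` [set: I]%SET]) A i) x.
    case: (pselect ((\bigcap_(i in [set` [set: I]%SET]) A i) x)) => [Ax|Ax].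
      rewrite indicE mem_set// big1// => i _; case: (AP i) => _ ->.
      by rewrite indicE mem_set//; apply: Ax; rewrite /= inE.
    rewrite indicE memNset//; apply/eqP; rewrite prodf_seq_eq0.
    case/existsNP: Ax => i /not_implyP[_ Ai]; apply/hasP; exists i => /=.
      by rewrite mem_index_enum.
    by case: (AP i) => _ ->; rewrite indicE memNset.
  have mA i : measurable (A i) by exact: (Fm (AP i).1).
  have := @Find [set: I]%SET A (fun i _ => (AP i).1).
  set B := \bigcap_(i in _) A i => PB.
  have mB : measurable B.
    by apply: fin_bigcap_measurable => // i _; exact: finite_finset.
  apply: has_mean_eq (fun x => esym (prodA x)) _.
  have := has_mean_indic P mB; rewrite -/B; congr has_mean.
  rewrite PB (eq_bigr (fun i => (e i)%:E)) => [|i _]; last first.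
    have [_ fi] := fe i; have [_ fA] := AP i; rewrite -fi fA.
    by rewrite integral_indic// setIT.
  by rewrite prodEFin/=; apply: eq_bigl => i; rewrite inE.
pose H x := \prod_(t | t != i) f t x; pose c := \prod_(t | t != i) e t.
have mf t : measurable_fun setT (f t) by exact: has_mean_measurable (fe t).
have key B : measurable B -> has_mean P (fun x => \1_(f i @^-1` B) x * H x)
    (fine (P (f i @^-1` B)) * c).
  move=> mB; pose f' t := if t == i then \1_(f i @^-1` B) else f t.
  pose e' t := if t == i then fine (P (f i @^-1` B)) else e t.
  have := IH ur f' e'; rewrite (bigD1 i)//= [in e' i]/e' eqxx.
  rewrite (eq_bigr e) => [|t /negbTE ti]; last by rewrite /e' ti.
  move=> H'; apply: has_mean_eq (H' _ _ _ _) => [x|t x|t tr|t tr|t].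
  - rewrite (bigD1 i)//= /f' eqxx; congr (_ * _).
    by apply: eq_bigr => t /negbTE ->.
  - by rewrite /f'; case: ifP => // _; rewrite indicE.
  - rewrite /f'; case: ifPn => [/eqP ti|ti]; first by rewrite ti (negbTE ir) in tr.
    by apply: fr; rewrite inE tr orbT.
  - rewrite /f'; case: ifPn => [/eqP ti|ti].
      by exists (f i @^-1` B) => //; rewrite ti; apply: fr => //; rewrite inE eqxx.
    by apply: fnr; rewrite inE negb_or ti.
  - rewrite /f' /e'; case: ifPn => [/eqP ti|ti] //.
    apply: has_mean_indic; rewrite -[X in measurable X]setTI; exact: mf.
have H0 x : 0 <= H x by apply: prodr_ge0.
have mH : measurable_fun setT H.
  rewrite /H.
  under eq_fun do rewrite big_mkcond.
  by apply: measurable_prod => t _; case: (t != i).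
have V12 B : measurable B ->
    (P (f i @^-1` B) * c%:E)%E = (\int[P]_(x in f i @^-1` B) (H x)%:E)%E.
  move=> mB; have [_] := key B mB; rewrite EFinM fineK; last first.
    apply: fin_num_measure; rewrite -[X in measurable X]setTI; exact: mf.
  move=> <-; rewrite [RHS]integral_mkcond; apply: eq_integral => x _.
  rewrite patchE indicE; case: ifPn => [xB|xB]; first by rewrite mul1r.
  by rewrite mul0r.
(* The test function must be nonnegative on all of [R], so the absolute value stands for the
   identity, with which it agrees on the values of [f i]. *)
have := density_transfer (mf i) (mf i) mH H0 V12 (@normr_measurable R setT)
  (fun x => normr_ge0 x).
under eq_integral do rewrite ger0_norm//.
under [X in _ = X]eq_integral do rewrite ger0_norm// -EFinM.
rewrite (fe i).2 -EFinM => fiH; rewrite (bigD1 i)//=.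
have {}fiH : has_mean P (fun x => f i x * H x) (e i * c).
  apply: has_mean_ge0; rewrite -?fiH//; last by move=> x; rewrite mulr_ge0.
  exact: measurable_funM.
by apply: has_mean_eq fiH => x; rewrite [RHS](bigD1 i).
Qed.

(** Each factor is its positive part minus its negative part; expanding the product over all choices
    of signs reduces to nonnegative factors. *)
Lemma has_mean_prod (f : I -> T -> R) (e : I -> R) :
  (forall i, generated_by (F i) (f i)) -> (forall i, has_mean P (f i) (e i)) ->
  has_mean P (fun x => \prod_i f i x) (\prod_i e i).
Proof.
move=> Ff fe; pose g i (b : bool) x := Num.max ((-1) ^+ b * f i x) 0.
have mg (b : bool) : measurable_fun setT (fun y : R => Num.max ((-1) ^+ b * y) 0).
  by apply: measurable_maxr => //; exact: measurable_funM.
have mf i : measurable_fun setT (f i) by exact: has_mean_measurable (fe i).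
have g0 i b x : 0 <= g i b x by rewrite le_max lexx orbT.
have gf i x : f i x = \sum_(b : bool) (-1) ^+ b * g i b x.
  rewrite big_bool/= /g/= expr0 expr1 !mul1r !mulN1r.
  case: (leP 0 (f i x)) => fx.
    have /max_idPr -> : - f i x <= 0 by rewrite oppr_le0.
    by rewrite oppr0 add0r.
  have /max_idPl -> : 0 <= - f i x by rewrite oppr_ge0 ltW.
  by rewrite opprK addr0.
have /choice[E gE] : forall ib : I * bool, exists e', has_mean P (g ib.1 ib.2) e'.
  move=> [i b]; have [e' fe'] := has_mean_normr (fe i).
  apply: (has_mean_dominated _ _ fe').
  - exact: (measurableT_comp (mg b)).
  - move=> x; rewrite ger0_norm// ge_max normr_ge0 andbT.
    by rewrite (le_trans (ler_norm _))// normrM normrX normrN1 expr1n mul1r.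
have eE i : e i = \sum_(b : bool) (-1) ^+ b * E (i, b).
  apply: (has_mean_unique (fe i)).
  apply: has_mean_eq (fun x => esym (gf i x)) _.
  by apply: has_mean_sum => b; apply: has_meanZ; exact: (gE (i, b)).
rewrite (eq_bigr _ (fun i _ => eE i)) bigA_distr_bigA.
apply: (@has_mean_eq _ _ _ _ (fun x => \sum_(s : {ffun I -> bool})
    (\prod_i (-1) ^+ s i * \prod_i g i (s i) x))) => [x|].
  rewrite (eq_bigr _ (fun i _ => gf i x)) bigA_distr_bigA.
  by apply: eq_bigr => s _; rewrite big_split.
apply: has_mean_sum => s; rewrite big_split/=; apply: has_meanZ.
apply: (mean_prod_seq (index_enum_uniq I)) => [i x|i _|i|i]//.
- exact: (generated_by_comp (mg _) (Ff i)).
- by rewrite mem_index_enum.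
- exact: (gE (i, s i)).
Qed.
End independent_products.

(** * Moments of sums of independent variables *)

(** This rewrites a monomial such as [a i * a j] as a product over every index, with multiplicities
    as exponents, which is the form that [has_mean_prod] handles even when indices coincide. *)
Lemma prod_pow_eq (R : comPzRingType) (I : finType) (i : I) (a : I -> R) :
  \prod_t a t ^+ (t == i) = a i.
Proof.
rewrite (bigD1 i)//= eqxx expr1 big1 ?mulr1// => t /negbTE ->.
by rewrite expr0.
Qed.

Section monomial_bound.
Context {R : realFieldType} (I : finType) (w : I -> nat -> R) (s : I -> R).
Hypotheses (w0 : forall t, w t 0%N = 1) (w1 : forall t, w t 1%N = 0).
Hypotheses (w2 : forall t, 0 <= w t 2%N <= s t).
Hypothesis (w4 : forall t, w t 4%N <= s t ^+ 2).

Let M i j k l := \prod_t w t ((t == i) + (t == j) + (t == k) + (t == l))%N.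

Let s0 t : 0 <= s t. Proof. by case/andP: (w2 t) => /le_trans; apply. Qed.

Let M_single i j k l : i != j -> i != k -> i != l -> M i j k l = 0.
Proof.
move=> /negbTE ij /negbTE ik /negbTE il.
by rewrite /M (bigD1 i)//= eqxx ij ik il w1 mul0r.
Qed.

(** If [k] and [l] differ, one of them is also distinct from [i], hence occurs only once and
    annihilates the monomial. The fourth moment enters only when all indices agree. *)
Let M_pair i k l : M i i k l <= (k == l)%:R * (s i * s k).
Proof.
have perm a b c d : M a b c d = M c a b d /\ M a b c d = M d a b c.
  by split; apply: eq_bigr => t _; congr (w t _); rewrite ?addnA; lia.
case: (eqVneq k l) => [<-|kl]; last first.
  rewrite mul0r; case: (eqVneq k i) => [ki|ki].
    by rewrite (perm _ _ _ _).2 M_single// -?ki eq_sym.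
  by rewrite (perm _ _ _ _).1 M_single.
rewrite mul1r; case: (eqVneq k i) => [->|ki].
  rewrite /M (bigD1 i)//= eqxx big1 ?mulr1 => [|t /negbTE ->]; last exact: w0.
  by rewrite -expr2; exact: w4.
rewrite /M (bigD1 i)//= (bigD1 k)//= !eqxx eq_sym (negbTE ki) big1 => [|t].
  rewrite mulr1; have /andP[? ?] := w2 i; have /andP[? ?] := w2 k.
  exact: ler_pM.
by case/andP => /negbTE -> /negbTE ->; exact: w0.
Qed.

(* [w t j] stands for the [j]-th moment of the [t]-th summand: a monomial in which
   some index occurs exactly once has mean zero, so only paired indices remain. *)
Lemma sum_monomials_le :
  \sum_i \sum_j \sum_k \sum_l
     \prod_t w t ((t == i) + (t == j) + (t == k) + (t == l))%N
  <= 3 * (\sum_i s i) ^+ 2.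
Proof.
have swap i j k l : M i j k l = M i k j l /\ M i j k l = M i l j k.
  by split; apply: eq_bigr => t _; congr (w t _); lia.
have pos (b : bool) x y : 0 <= b%:R * (s x * s y).
  by rewrite mulr_ge0 ?mulr_ge0.
(* The three ways to pair four indices. They overlap when all indices agree, which only enlarges the
   bound, and each sums to the square of the sum of [s]. *)
pose Q i j k l := (i == j)%:R * ((k == l)%:R * (s i * s k))
   + (i == k)%:R * ((j == l)%:R * (s i * s j))
   + (i == l)%:R * ((j == k)%:R * (s i * s j)).
have MQ i j k l : M i j k l <= Q i j k l.
  rewrite /Q; case: (eqVneq i j) => [->|ij].
    by rewrite mul1r -addrA (le_trans (M_pair _ _ _))// lerDl addr_ge0// mulr_ge0.
  case: (eqVneq i k) => [->|ik].
    rewrite mul0r add0r mul1r (swap _ _ _ _).1 (le_trans (M_pair _ _ _))// lerDl.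
    by rewrite mulr_ge0.
  case: (eqVneq i l) => [->|il]; last by rewrite M_single// !mul0r !addr0.
  by rewrite !mul0r !add0r mul1r (swap _ _ _ _).2.
apply: le_trans (ler_sum _ (fun i _ => ler_sum _ (fun j _ =>
  ler_sum _ (fun k _ => ler_sum _ (fun l _ => MQ i j k l))))) _.
have delta (x : I) (a : I -> R) : \sum_y (x == y)%:R * a y = a x.
  rewrite (bigD1 x)//= eqxx mul1r big1 ?addr0// => y.
  by rewrite eq_sym => /negbTE ->; rewrite mul0r.
have SS : \sum_i \sum_k s i * s k = (\sum_i s i) ^+ 2.
  by rewrite expr2 big_distrlr.
rewrite -SS; apply: eq_ler.
transitivity (\sum_i \sum_k s i * s k + \sum_i \sum_k s i * s k
   + \sum_i \sum_k s i * s k); last by ring.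
rewrite -!big_split/=; apply: eq_bigr => i _.
transitivity (\sum_j (\sum_k \sum_l (i == j)%:R * ((k == l)%:R * (s i * s k))
  + \sum_k \sum_l (i == k)%:R * ((j == l)%:R * (s i * s j))
  + \sum_k \sum_l (i == l)%:R * ((j == k)%:R * (s i * s j)))).
  apply: eq_bigr => j _; rewrite -!big_split/=; apply: eq_bigr => k _.
  by rewrite -!big_split/=.
rewrite !big_split/=; congr (_ + _ + _).
- under eq_bigr => j _ do under eq_bigr => k _ do rewrite -mulr_sumr delta.
  by under eq_bigr => j _ do rewrite -mulr_sumr; rewrite delta.
- apply: eq_bigr => j _.
  under eq_bigr => k _ do rewrite -mulr_sumr delta.
  exact: (delta i (fun=> s i * s j)).
- apply: eq_bigr => j _; rewrite exchange_big/=.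
  under eq_bigr => l _ do rewrite -mulr_sumr (delta j (fun=> s i * s j)).
  exact: (delta i (fun=> s i * s j)).
Qed.

End monomial_bound.

Section moments_of_independent_sums.
Local Open Scope classical_set_scope.
Context d (T : measurableType d) (R : realType) (P : probability T R).
Context (I : finType) (F : I -> set (set T)).
Hypothesis Fm : forall i, F i `<=` measurable.
Hypothesis Find : mutually_independent P F.
Variables (U : I -> T -> R) (v : I -> R).
Hypothesis UF : forall i, generated_by (F i) (U i).
Hypothesis U1 : forall i, has_mean P (U i) 0.
Hypothesis U2 : forall i, has_mean P (fun x => U i x ^+ 2) (v i).

Let UFX t m : generated_by (F t) (fun x => U t x ^+ m).
Proof. exact: (generated_by_comp (@exprn_measurable R setT m) (UF t)). Qed.

(* The index [b], whose summand vanishes, carries the weight [B]. *)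
Lemma mean_weighted_sqr_sum (b : I) (B : T -> R) (beta : R) :
  (forall x, U b x = 0) -> generated_by (F b) B -> has_mean P B beta ->
  has_mean P (fun x => B x * (\sum_i U i x) ^+ 2) (beta * \sum_i v i).
Proof.
move=> Ub BF Bbeta; pose w i m := if m is 0%N then 1 else if m is 1%N then 0 else v i.
have vb : v b = 0.
  apply: has_mean_unique (U2 b) _; apply: has_mean_eq (has_mean_cst P 0) => x.
  by rewrite Ub expr0n.
have term i j : has_mean P (fun x => B x * (U i x * U j x))
    (beta * ((i == j)%:R * v i)).
  have [ib|ib] := eqVneq i b.
    rewrite ib vb !mulr0; apply: has_mean_eq (has_mean_cst P 0) => x.
    by rewrite Ub mul0r mulr0.
  have [jb|jb] := eqVneq j b.
    rewrite jb (negbTE ib) mul0r mulr0; apply: has_mean_eq (has_mean_cst P 0) => x.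
    by rewrite Ub !mulr0.
  pose m t := ((t == i) + (t == j))%N.
  have mb : m b = 0%N by rewrite /m eq_sym (negbTE ib) eq_sym (negbTE jb).
  have -> : beta * ((i == j)%:R * v i) =
      \prod_t (if t == b then beta else w t (m t)).
    rewrite [RHS](bigD1 b)//= eqxx; congr (_ * _); rewrite (bigD1 i)//= (negbTE ib).
    have [ij|ij] := eqVneq i j.
      rewrite /m ij eqxx/= mul1r big1 ?mulr1// => t /andP[/negbTE -> /negbTE tj].
      by rewrite tj.
    by rewrite /m eqxx (negbTE ij)/= !mul0r.
  apply: has_mean_eq (@has_mean_prod _ _ _ _ _ _ Fm Find
    (fun t => if t == b then B else fun x => U t x ^+ m t) _ _ _) => [x|t|t].
  - rewrite (bigD1 b)//= eqxx; congr (_ * _).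
    transitivity (\prod_t U t x ^+ m t).
      rewrite [RHS](bigD1 b)//= mb expr0 mul1r.
      by apply: eq_bigr => t /negbTE ->.
    by under eq_bigr do rewrite exprD; rewrite big_split/= !prod_pow_eq.
  - case: ifPn => [/eqP ->//|tb]; exact: UFX.
  - case: ifPn => [//|tb]; rewrite /m; case: (t == i); case: (t == j) => /=.
    + exact: U2.
    + exact: U1.
    + exact: U1.
    + exact: has_mean_cst.
have := has_mean_sum (fun i => has_mean_sum (fun j => term i j)).
congr has_mean.
  apply/funext => x; under eq_bigr do rewrite -mulr_sumr.
  by rewrite -mulr_sumr expr2 big_distrlr.
rewrite mulr_sumr; apply: eq_bigr => i _; rewrite -mulr_sumr (bigD1 i)//= eqxx mul1r.
by rewrite big1 ?addr0// => j; rewrite eq_sym => /negbTE ->; rewrite mul0r.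
Qed.

Lemma mean_sum_pow4 (s : I -> R) : (forall i, v i <= s i) ->
  (forall i, exists2 q, has_mean P (fun x => U i x ^+ 4) q & q <= s i ^+ 2) ->
  exists2 e, has_mean P (fun x => (\sum_i U i x) ^+ 4) e & e <= 3 * (\sum_i s i) ^+ 2.
Proof.
move=> vs U4.
have v0 i : 0 <= v i.
  by apply: (has_mean_le (has_mean_cst P 0) (U2 i)) => x; exact: sqr_ge0.
have /choice[w wP] : forall i, exists wi : nat -> R,
    [/\ wi 0%N = 1, wi 1%N = 0, wi 2%N = v i, wi 4%N <= s i ^+ 2 &
      forall m, (m <= 4)%N -> has_mean P (fun x => U i x ^+ m) (wi m)].
  move=> i; have [q q4 qs] := U4 i.
  (* Exponent 3 occurs in some monomials, so the cube must have a mean; its value is free, since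
     such a monomial also contains an index of exponent 1. *)
  have [q' q3] : exists q', has_mean P (fun x => U i x ^+ 3) q'.
    apply: (has_mean_dominated _ _ (has_meanD (has_mean_cst P 1) q4)) => [|x].
      by apply: measurable_funX; exact: has_mean_measurable (U1 i).
    rewrite normrX -[U i x ^+ 4]ger0_norm ?normrX; last by rewrite (exprM _ 2 2) sqr_ge0.
    move: (normr_ge0 (U i x)); move: `|U i x| => u u0.
    have [u1|u1] := leP u 1; first by rewrite ler_wpDr ?exprn_ge0// exprn_ile1.
    by rewrite ler_wpDl// ler_weXn2l// ltW.
  exists (nth 0 [:: 1; 0; v i; q'; q]); split => //.
  do 5?[case=> [_|]] => //=.
  - exact: has_mean_cst.
  - exact: U1.
have mono i j k l : has_mean P (fun x => U i x * U j x * U k x * U l x)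
    (\prod_t w t ((t == i) + (t == j) + (t == k) + (t == l))%N).
  pose m t := ((t == i) + (t == j) + (t == k) + (t == l))%N.
  apply: has_mean_eq (@has_mean_prod _ _ _ _ _ _ Fm Find
    (fun t x => U t x ^+ m t) (fun t => w t (m t)) _ _) => [x|t|t].
  - under eq_bigr do rewrite !exprD.
    by rewrite !big_split/= !prod_pow_eq.
  - exact: UFX.
  - case: (wP t) => _ _ _ _; apply.
    by rewrite /m; do 4![case: (_ == _)].
have := has_mean_sum (fun i => has_mean_sum (fun j => has_mean_sum (fun k =>
  has_mean_sum (fun l => mono i j k l)))).
set e := \sum_i _ => He; exists e.
  apply: has_mean_eq He => x.
  under eq_bigr do under eq_bigr do under eq_bigr do rewrite -mulr_sumr.
  under eq_bigr do under eq_bigr do rewrite -mulr_suml -mulr_sumr.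
  under eq_bigr do rewrite -mulr_suml -mulr_suml -mulr_sumr.
  by rewrite -!mulr_suml; rewrite !exprS expr0 mulr1 !mulrA.
apply: sum_monomials_le => t; case: (wP t) => // _ _ ->; by rewrite v0 vs.
Qed.

End moments_of_independent_sums.

(** * Moments of the Laplace distribution *)

Section laplace_moments.
Local Open Scope classical_set_scope.
Context {R : realType}.
Notation mu := (@lebesgue_measure R).

Lemma continuous_laplace_pdf : continuous (@laplace_pdf R).
Proof.
move=> x; apply: (@continuousM R R (fun x => expR (- `|x|)) (fun=> 2^-1));
  last exact: cst_continuous.
apply: (@continuous_comp _ _ _ (fun x : R => - `|x|) expR).
  by apply: continuousN; exact: norm_continuous.
exact: continuous_expR.
Qed.

Lemma laplace_pdf_ge0 (x : R) : 0 <= laplace_pdf x.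
Proof. by rewrite divr_ge0// expR_ge0. Qed.

Lemma measurable_laplace_pdf : measurable_fun setT (@laplace_pdf R).
Proof. by apply: continuous_measurable_fun; exact: continuous_laplace_pdf. Qed.

Lemma integral_reflect (f : R -> R) : measurable_fun setT f -> (forall x, 0 <= f x) ->
  (\int[mu]_x (f (- x))%:E = \int[mu]_x (f x)%:E)%E.
Proof.
move=> mf f0.
pose phi : R -> measurableTypeR R := -%R.
have mphi : measurable_fun setT phi by exact: oppr_measurable.
transitivity (\int[pushforward mu phi]_x (f x)%:E)%E.
  rewrite ge0_integral_pushforward//; first exact/measurable_EFinP.
  by move=> y _; rewrite lee_fin.
by apply: eq_measure_integral => //= A mA _; exact: lebesgue_measureN.
Qed.

(** The integrand is [exp(-|x|/2) / 2], which on the half-line is the exponential density of rate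
    1/2; symmetry doubles its integral. A single exponential moment then dominates every polynomial
    moment of the noise. *)
Lemma integral_expR_half_norm :
  (\int[mu]_x (expR (2^-1 * `|x|) * laplace_pdf x)%:E = 2%:E)%E.
Proof.
pose f (x : R) := expR (- (2^-1 * `|x|)) / 2.
have fE x : expR (2^-1 * `|x|) * laplace_pdf x = f x.
  by rewrite /laplace_pdf /f mulrA -expRD; congr (expR _ / 2); lra.
under eq_integral do rewrite fE.
rewrite ge0_symfun_integralT; last 3 first.
- by move=> x; rewrite divr_ge0// expR_ge0.
- move=> x; apply: (@continuousM R R (fun x => expR (- (2^-1 * `|x|))) (fun=> 2^-1));
    last exact: cst_continuous.
  apply: (@continuous_comp _ _ _ (fun x : R => - (2^-1 * `|x|)) expR).
    by apply: continuousN; apply: (@continuousM R R (fun=> 2^-1));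
      [exact: cst_continuous|exact: norm_continuous].
  exact: continuous_expR.
- by move=> x; rewrite /f/= normrN.
rewrite (_ : \int[mu]_(x in _) _ = 1)%E ?mule1//.
rewrite -(@integral_exponential_pdf R (2^-1))// integral_mkcond; apply: eq_integral => x _.
rewrite patchE /exponential_pdf patchE.
have -> : (x \in [set x | 0 <= x]) = (x \in `[0, +oo[).
  by apply/idP/idP; rewrite !inE/= in_itv/= andbT.
case: ifPn => //; rewrite inE/= in_itv/= andbT => x0.
by rewrite /f ger0_norm// mulrC mulNr.
Qed.

Context d (T : measurableType d) (P : probability T R) (W : T -> R).
Hypothesis (mW : measurable_fun setT W) (W_law : laplace_law P W).

Lemma laplace_law_integral (g : R -> R) : measurable_fun setT g ->
  (forall x, 0 <= g x) ->
  (\int[P]_w (g (W w))%:E = \int[mu]_x (g x * laplace_pdf x)%:E)%E.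
Proof.
move=> mg g0.
have := @density_transfer R _ _ _ _ P mu W idfun (@laplace_pdf R) 1 mW
  (@measurable_id _ _ setT) measurable_laplace_pdf laplace_pdf_ge0 _ g mg g0.
by rewrite mule1; apply => B mB; rewrite mule1; exact: W_law.
Qed.

(** From [x/8 <= exp(x/8)] comes [x^4 <= 8^4 exp(x/2)], and 2 is the mean of [exp(|W|/2)]; the extra
    1 serves [W^2 <= 1 + W^4]. This crude number bounds the second moment and its square bounds the
    fourth. *)
Definition laplace_moment_bound : R := 1 + 8 ^+ 4 * 2.

Let mean_exp : has_mean P (fun w => expR (2^-1 * `|W w|)) 2.
Proof.
have mg : measurable_fun setT (fun x : R => expR (2^-1 * `|x|)).
  apply: (measurableT_comp (@measurable_expR R)); apply: measurable_funM => //.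
apply: has_mean_ge0 => [|w|]; last 2 first.
- exact: expR_ge0.
- rewrite (laplace_law_integral mg) => [|x]; last exact: expR_ge0.
  exact: integral_expR_half_norm.
exact: (measurableT_comp mg mW).
Qed.

Let mean_pow4 : exists2 q, has_mean P (fun w => W w ^+ 4) q & q <= 8 ^+ 4 * 2.
Proof.
have W4 w : `|W w ^+ 4| <= 8 ^+ 4 * expR (2^-1 * `|W w|).
  rewrite normrX; move: `|W w| (normr_ge0 (W w)) => x x0.
  rewrite (_ : 2^-1 * x = 4%:R * (x / 8)); last by lra.
  rewrite expRM_natl -exprMn lerXn2r ?nnegrE ?mulr_ge0 ?expR_ge0//.
  by rewrite -ler_pdivrMl// mulrC (le_trans _ (expR_ge1Dx _))// lerDr.
have H := has_meanZ (8 ^+ 4) mean_exp.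
have [q Hq] := has_mean_dominated (measurable_funX 4 mW) W4 H.
by exists q => //; exact: has_mean_le Hq H (fun w => le_trans (ler_norm _) (W4 w)).
Qed.

Lemma laplace_moment_bound_ge1 : 1 <= laplace_moment_bound.
Proof. by rewrite lerDl mulr_ge0// exprn_ge0. Qed.

Lemma laplace_mean_pow4 : exists2 q, has_mean P (fun w => W w ^+ 4) q &
  q <= laplace_moment_bound ^+ 2.
Proof.
have [q Hq q_le] := mean_pow4; exists q => //; apply: le_trans q_le _.
rewrite (@le_trans _ _ laplace_moment_bound) ?lerDr//.
by rewrite expr2 ler_peMl ?(le_trans _ laplace_moment_bound_ge1)// laplace_moment_bound_ge1.
Qed.

Lemma laplace_mean_sqr : exists2 v, has_mean P (fun w => W w ^+ 2) v &
  v <= laplace_moment_bound.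
Proof.
have [q Hq qle] := mean_pow4.
have W2 w : `|W w ^+ 2| <= 1 + W w ^+ 4.
  rewrite ger0_norm ?sqr_ge0// (exprM _ 2 2); move: (W w ^+ 2) (sqr_ge0 (W w)) => x x0.
  by have := sqr_ge0 (x - 1); rewrite sqrrB; nra.
have H := has_meanD (has_mean_cst P 1) Hq.
have [v Hv] := has_mean_dominated (measurable_funX 2 mW) W2 H.
exists v => //; have := has_mean_le Hv H (fun w => le_trans (ler_norm _) (W2 w)).
by move/le_trans; apply; rewrite lerD2l.
Qed.

(** By symmetry of the density the positive and negative parts have equal means. They are treated
    separately because the integral formula is for nonnegative integrands. *)
Lemma laplace_mean : has_mean P W 0.
Proof.
have [v Hv _] := laplace_mean_sqr.
have mp : measurable_fun setT (fun x : R => Num.max x 0).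
  exact: measurable_maxr.
have mn : measurable_fun setT (fun x : R => Num.max (- x) 0).
  by apply: measurable_maxr => //; exact: oppr_measurable.
have dom (g : R -> R) : measurable_fun setT g -> (forall x, `|g x| <= `|x|) ->
    exists e, has_mean P (fun w => g (W w)) e.
  move=> mg gx; apply: (has_mean_dominated _ _ (has_meanD (has_mean_cst P 1) Hv)) => [|w].
    exact: measurableT_comp mg mW.
  apply: le_trans (gx _) _; rewrite -[W w ^+ 2]ger0_norm ?sqr_ge0// normrX.
  by move: `|W w| => x; have := sqr_ge0 (x - 1); nra.
have [a Ha] : exists a, has_mean P (fun w => Num.max (W w) 0) a.
  apply: (dom (fun x => Num.max x 0)) => // x; rewrite ger0_norm ?le_max ?lexx ?orbT//.
  by rewrite ge_max ler_norm normr_ge0.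
have Hb : has_mean P (fun w => Num.max (- W w) 0) a.
  apply: has_mean_ge0 => [|w|]; first exact: measurableT_comp mn mW.
    by rewrite le_max lexx orbT.
  rewrite -Ha.2 (laplace_law_integral mp) => [|x]; last by rewrite le_max lexx orbT.
  rewrite (laplace_law_integral mn) => [|x]; last by rewrite le_max lexx orbT.
  rewrite -(@integral_reflect (fun x => Num.max x 0 * laplace_pdf x)).
  - by apply: eq_integral => x _; rewrite /laplace_pdf normrN.
  - by apply: measurable_funM => //; exact: measurable_laplace_pdf.
  - by move=> x; rewrite mulr_ge0 ?laplace_pdf_ge0// le_max lexx orbT.
have := has_meanD Ha (has_meanZ (-1) Hb); rewrite mulN1r subrr.
apply: has_mean_eq => w; rewrite mulN1r.
by case: (leP 0 (W w)) => W0; [rewrite max_r ?oppr_le0//|rewrite max_l ?oppr_ge0 ?ltW//];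
  rewrite ?subr0 ?sub0r ?opprK.
Qed.

End laplace_moments.

(** * Moments of the private frequencies *)

Lemma sum_pairE (R : nmodType) (A B : finType) (f : A * B -> R) :
  \sum_q f q = \sum_i \sum_k f (i, k).
Proof. by rewrite pair_bigA; apply: eq_bigr => -[]. Qed.

Section categorical_variables.
Local Open Scope classical_set_scope.
Context d (T : measurableType d) (R : realType) (P : probability T R).
Context (K : nat) (p : 'I_K -> R) (X : T -> 'I_K).

Lemma sigma_cat_generates (h : 'I_K -> R) :
  generated_by (sigma_cat X) (fun w => h (X w)).
Proof. by move=> B mB; exists (h @^-1` B) => //; rewrite setTI. Qed.

Hypothesis X_law : categorical_law P X p.

Lemma sigma_cat_measurable : sigma_cat X `<=` measurable.
Proof.
move=> _ [B _ <-]; rewrite setTI.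
have -> : X @^-1` B = \bigcup_(k in B) X @^-1` [set k].
  by apply/seteqP; split => [w Bw|w [k Bk] /= Xk]; [exists (X w)|rewrite /preimage/= Xk].
by apply: fin_bigcup_measurable => [|k _]; [exact: finite_finset|case: (X_law k)].
Qed.

Lemma categorical_indicE k w : (X w == k)%:R = \1_(X @^-1` [set k]) w :> R.
Proof.
by rewrite indicE; case: eqVneq => [Xk|/eqP Xk]; [rewrite mem_set|rewrite memNset].
Qed.

Lemma categorical_mean (h : 'I_K -> R) :
  has_mean P (fun w => h (X w)) (\sum_k h k * p k).
Proof.
apply: (@has_mean_eq _ _ _ _ (fun w => \sum_k h k * \1_(X @^-1` [set k]) w)) => [w|].
  rewrite (bigD1 (X w))//= -categorical_indicE eqxx mulr1 big1 ?addr0// => k kX.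
  by rewrite -categorical_indicE eq_sym (negbTE kX) mulr0.
apply: has_mean_sum => k; apply: has_meanZ.
by have [mX XE] := X_law k; have := has_mean_indic P mX; rewrite XE.
Qed.

End categorical_variables.

Section experiment_moments.
Local Open Scope classical_set_scope.
Context {R : realType} (K n : nat) (alpha gamma : R) (p : 'I_K -> R).
Context d (T : measurableType d) (P : probability T R).
Variable E : experiment n alpha gamma p P.
Hypotheses (n0 : (0 < n)%N) (alpha01 : 0 < alpha < 1) (p_simplex : prob_simplex p).

Notation I := ('I_n + 'I_n + 'I_n * 'I_K)%type.
Notation kappa := (@laplace_moment_bound R).
Notation m := (alpha ^+ 2 * n%:R).

Let F (j : I) : set (set T) :=
  match j with
  | inl (inl i) => sigma_cat (X1 E i)
  | inl (inr i) => sigma_cat (X2 E i)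
  | inr (i, k) => sigma_real (W E i k)
  end.

Let Find : mutually_independent P F := X1_X2_W_independent (e := E).

Let Fm j : F j `<=` measurable.
Proof.
case: j => [[i|i]|[i k]] /=.
- exact: sigma_cat_measurable (X1_law E i).
- exact: sigma_cat_measurable (X2_law E i).
- by move=> _ [B mB <-]; exact: measurable_funP.
Qed.

Let p0 k : 0 <= p k. Proof. by have [/(_ k)/andP[]] := p_simplex. Qed.
Let p1 : \sum_k p k = 1. Proof. by case: p_simplex. Qed.

Let convex_comb01 (h : 'I_K -> R) : (forall k, 0 <= h k <= 1) ->
  0 <= \sum_k h k * p k <= 1.
Proof.
move=> h01; apply/andP; split.
  by apply: sumr_ge0 => k _; rewrite mulr_ge0//; case/andP: (h01 k).
rewrite -[leRHS]p1; apply: ler_sum => k _.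
by rewrite ler_piMl//; case/andP: (h01 k).
Qed.

Let centered (h : 'I_K -> R) k := n%:R^-1 * (h k - \sum_l h l * p l).

Let nN0 : n%:R != 0 :> R. Proof. by rewrite pnatr_eq0 -lt0n. Qed.
Let ninv0 : 0 < n%:R^-1 :> R. Proof. by rewrite invr_gt0 ltr0n. Qed.

Let centered_moments (X : T -> 'I_K) h : categorical_law P X p ->
    (forall k, 0 <= h k <= 1) ->
  [/\ has_mean P (fun w => centered h (X w)) 0,
      exists2 v, has_mean P (fun w => centered h (X w) ^+ 2) v & v <= n%:R^-1 ^+ 2 &
      exists2 q, has_mean P (fun w => centered h (X w) ^+ 4) q &
        q <= (n%:R^-1 ^+ 2) ^+ 2].
Proof.
move=> X_law h01.
have bd k : `|centered h k| <= n%:R^-1.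
  rewrite normrM gtr0_norm// ler_piMr ?(ltW ninv0)//.
  by have /andP[? ?] := h01 k; have /andP[? ?] := convex_comb01 h01; rewrite ler_norml; lra.
have even j : exists2 v, has_mean P (fun w => centered h (X w) ^+ j) v & v <= n%:R^-1 ^+ j.
  have Hv := categorical_mean X_law (fun k => centered h k ^+ j).
  eexists; first exact: Hv.
  apply: (has_mean_le Hv (has_mean_cst P _)) => w.
  by rewrite (le_trans (ler_norm _))// normrX lerXn2r// nnegrE ltW.
split; [|exact: even|by rewrite -exprM; exact: even].
have := categorical_mean X_law (centered h); congr has_mean.
rewrite /centered; under eq_bigr do rewrite -mulrA mulrBl.
by rewrite -mulr_sumr sumrB -mulr_sumr p1 mulr1 subrr mulr0.
Qed.

Section linear_form.
Variable a : 'I_K -> R.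
Hypothesis a01 : forall k, 0 <= a k <= 1.

(** The indicator of one category as [a] gives a single deviation; [a k = p k ^ (gamma - 1)] gives,
    up to the factor [gamma], the first-order term of the plug-in estimator. *)
Definition linear_form w : R :=
  \sum_k a k * (zhat (fun i k => Z1 E i k w) k - p k).

(** The counts of distinct categories are dependent, so all the contributions of one datum are
    grouped in one summand, while each noise variable has its own. The second sample gets zero
    summands, which leaves its indices free to carry a weight. *)
Let U (j : I) (w : T) : R :=
  match j with
  | inl (inl i) => centered a (X1 E i w)
  | inl (inr i) => 0
  | inr (i, k) => n%:R^-1 * (2 / alpha) * a k * W E i k w
  end.

Let linear_formE w : linear_form w = \sum_j U j w.
Proof.
rewrite !big_sumType/= [X in _ + X + _]big1// addr0.
rewrite sum_pairE/=.
rewrite /linear_form.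
transitivity (\sum_k n%:R^-1 * \sum_i (a k * ((X1 E i w == k)%:R - p k) +
    2 / alpha * a k * W E i k w)).
  apply: eq_bigr => k _; rewrite /zhat.
  rewrite -{1}[p k](mulKf nN0) -mulrBr mulrCA; congr (_ * _).
  have -> : n%:R * p k = \sum_(i < n) p k by rewrite sumr_const card_ord mulr_natl.
  rewrite -sumrB mulr_sumr.
  by apply: eq_bigr => i _; rewrite /Z1 /laplace_release; ring.
rewrite -mulr_sumr exchange_big/= mulr_sumr -big_split/=; apply: eq_bigr => i _.
rewrite big_split/= mulrDr; congr (_ + _).
  rewrite /centered; congr (_ * _).
  under eq_bigr do rewrite mulrBr; rewrite sumrB; congr (_ - _).
  rewrite (bigD1 (X1 E i w))//= eqxx mulr1 big1 ?addr0// => k.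
  by rewrite eq_sym => /negbTE ->; rewrite mulr0.
by rewrite mulr_sumr; apply: eq_bigr => k _; rewrite !mulrA.
Qed.

Let s (j : I) : R :=
  match j with
  | inl (inl i) => n%:R^-1 ^+ 2
  | inl (inr i) => 0
  | inr (i, k) => (n%:R^-1 * (2 / alpha) * a k) ^+ 2 * kappa
  end.

(** The data contribute [1/n], at most [1/m] because [alpha < 1]; the noise contributes [n] times
    the squared scale [(2 / (alpha n))^2], weighted by the [a k ^+ 2]. *)
Definition linear_form_rate : R := (1 + 4 * kappa * \sum_k a k ^+ 2) / m.

Let sum_s : \sum_j s j <= linear_form_rate.
Proof.
rewrite !big_sumType/= [X in _ + X + _]big1// addr0.
rewrite sum_pairE/= !sumr_const card_ord.
rewrite /linear_form_rate [leRHS]mulrDl mul1r.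
have /andP[al0 al1] := alpha01.
have nR0 : 0 < n%:R :> R by rewrite ltr0n.
apply: lerD.
  rewrite -[leLHS]mulr_natr expr2 -mulrA mulVf// mulr1 invfM ler_peMl ?(ltW ninv0)//.
  by rewrite invf_ge1 ?exprn_gt0// expr_le1// ltW.
rewrite -[leLHS]mulr_natr; apply: eq_ler.
transitivity ((n%:R^-1 * (2 / alpha)) ^+ 2 * kappa * (\sum_k a k ^+ 2) * n%:R).
  congr (_ * _); rewrite mulr_sumr; apply: eq_bigr => k _; ring.
by field; rewrite nN0 gt_eqF.
Qed.

Let UF j : generated_by (F j) (U j).
Proof.
case: j => [[i|i]|[i k]] /=.
- exact: (sigma_cat_generates _ (centered a)).
- exact: (sigma_cat_generates _ (fun=> 0)).
- apply: (@generated_by_comp _ _ _ _ (W E i k)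
    (fun x => n%:R^-1 * (2 / alpha) * a k * x)); first exact: measurable_funM.
  by move=> B mB; exists B => //; rewrite setTI.
Qed.

Let U_moments j :
  [/\ has_mean P (U j) 0,
      exists2 v, has_mean P (fun w => U j w ^+ 2) v & v <= s j &
      exists2 q, has_mean P (fun w => U j w ^+ 4) q & q <= s j ^+ 2].
Proof.
case: j => [[i|i]|[i k]] /=.
- exact: centered_moments (X1_law E i) a01.
- split; first exact: has_mean_cst.
    by exists 0 => //; rewrite expr0n; exact: has_mean_cst.
  by exists 0; rewrite ?expr0n//; exact: has_mean_cst.
- set c := n%:R^-1 * _ * _.
  have mW : measurable_fun setT (W E i k) by exact: measurable_funP.
  have Wlaw := @W_law _ _ _ _ _ _ _ _ _ E i k.
  split.
  + by have := has_meanZ c (laplace_mean mW Wlaw); rewrite mulr0.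
  + have [v Hv vle] := laplace_mean_sqr mW Wlaw.
    exists (c ^+ 2 * v); last by rewrite ler_wpM2l// sqr_ge0.
    by apply: has_mean_eq (has_meanZ _ Hv) => w; rewrite [RHS]exprMn.
  + have [v Hv vle] := laplace_mean_pow4 mW Wlaw.
    exists (c ^+ 4 * v).
      by apply: has_mean_eq (has_meanZ _ Hv) => w; rewrite [RHS]exprMn.
    by rewrite [leRHS]exprMn -exprM ler_wpM2l// (exprM _ 2 2) sqr_ge0.
Qed.

(** The weight depends on the second sample only, hence is independent of the linear form and its
    mean factors out. Taking [h] constant gives the plain second moment; taking an indicator serves
    the two-step estimator. *)
Lemma linear_form_mean_sqr (i : 'I_n) (h : 'I_K -> R) : (forall k, 0 <= h k) ->
  exists2 e, has_mean P (fun w => h (X2 E i w) * linear_form w ^+ 2) e &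
    e <= (\sum_k h k * p k) * linear_form_rate.
Proof.
move=> h0.
have /choice[v vP] : forall j, exists v,
    has_mean P (fun w => U j w ^+ 2) v /\ v <= s j.
  by move=> j; have [_ [v ? ?] _] := U_moments j; exists v.
have H := @mean_weighted_sqr_sum _ _ _ _ _ _ Fm Find U v UF
  (fun j => let: And3 H _ _ := U_moments j in H) (fun j => (vP j).1)
  (inl (inr i)) _ _ (fun=> erefl) (sigma_cat_generates _ h)
  (categorical_mean (X2_law E i) h).
exists ((\sum_k h k * p k) * \sum_j v j).
  by apply: has_mean_eq H => w; rewrite linear_formE.
rewrite ler_wpM2l ?sumr_ge0// => [k _|]; first by rewrite mulr_ge0.
by apply: le_trans sum_s; apply: ler_sum => j _; case: (vP j).
Qed.

Lemma linear_form_mean_pow4 :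
  exists2 e, has_mean P (fun w => linear_form w ^+ 4) e &
    e <= 3 * linear_form_rate ^+ 2.
Proof.
have /choice[v vP] : forall j, exists v,
    has_mean P (fun w => U j w ^+ 2) v /\ v <= s j.
  by move=> j; have [_ [v ? ?] _] := U_moments j; exists v.
have [e He ele] := @mean_sum_pow4 _ _ _ _ _ _ Fm Find U v UF
  (fun j => let: And3 H _ _ := U_moments j in H) (fun j => (vP j).1) s
  (fun j => (vP j).2) (fun j => let: And3 _ _ H := U_moments j in H).
exists e; first by apply: has_mean_eq He => w; rewrite linear_formE.
have s0 j : 0 <= s j.
  case: j => [[i|i]|[i k]]; rewrite /s ?sqr_ge0//.
  by rewrite mulr_ge0 ?sqr_ge0// (le_trans _ laplace_moment_bound_ge1).
have S0 : 0 <= \sum_j s j by apply: sumr_ge0.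
by rewrite (le_trans ele)// ler_wpM2l// lerXn2r ?sum_s// nnegrE (le_trans S0 sum_s).
Qed.

End linear_form.

Lemma second_sample_mean_sqr (h : 'I_K -> R) : (forall k, 0 <= h k <= 1) ->
  exists2 e, has_mean P (fun w =>
      (n%:R^-1 * \sum_(i < n) h (X2 E i w) - \sum_k h k * p k) ^+ 2) e &
    e <= n%:R^-1.
Proof.
move=> h01.
pose U (j : I) w := if j is inl (inr i) then centered h (X2 E i w) else 0.
have UF j : generated_by (F j) (U j).
  case: j => [[i|i]|[i k]] /=.
  - exact: (sigma_cat_generates _ (fun=> 0)).
  - exact: (sigma_cat_generates _ (centered h)).
  - apply: (@generated_by_comp _ _ _ _ (W E i k) (fun=> 0)) => //.
    by move=> B mB; exists B => //; rewrite setTI.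
pose s (j : I) : R := if j is inl (inr i) then n%:R^-1 ^+ 2 else 0.
have U_moments j : has_mean P (U j) 0 /\
    exists2 v, has_mean P (fun w => U j w ^+ 2) v & v <= s j.
  have z : has_mean P (fun=> 0) 0 /\
    exists2 v, has_mean P (fun _ : T => 0 ^+ 2) v & v <= 0.
    by split; [exact: has_mean_cst|exists 0; rewrite ?expr0n//; exact: has_mean_cst].
  case: j => [[i|i]|[i k]] //=.
  by have [? ? _] := centered_moments (X2_law E i) h01.
have /choice[v vP] : forall j, exists v,
    has_mean P (fun w => U j w ^+ 2) v /\ v <= s j.
  by move=> j; have [_ [v ? ?]] := U_moments j; exists v.
have H := @mean_weighted_sqr_sum _ _ _ _ _ _ Fm Find U v UF
  (fun j => (U_moments j).1) (fun j => (vP j).1)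
  (* The weight is the constant 1, carried by an index of the first sample, where the summands
     vanish. *)
  (inl (inl (Ordinal n0))) _ _ (fun=> erefl) (sigma_cat_generates _ (fun=> 1))
  (has_mean_cst P 1).
exists (1 * \sum_j v j).
  apply: has_mean_eq H => w; rewrite mul1r !big_sumType/= sum_pairE/=.
  rewrite [X in X + _ + _]big1// [X in _ + X]big1// => [|i _].
    rewrite add0r addr0 -mulr_sumr sumrB sumr_const card_ord mulrBr.
    by rewrite -[X in _ - _ * X]mulr_natl mulKf.
  by rewrite big1.
rewrite mul1r; apply: (@le_trans _ _ (\sum_j s j)).
  by apply: ler_sum => j _; case: (vP j).
rewrite !big_sumType/= sum_pairE/= [X in X + _ + _]big1// [X in _ + X]big1// => [|i _].
  by rewrite add0r addr0 sumr_const card_ord -[leLHS]mulr_natr expr2 -mulrA mulVf// mulr1.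
by rewrite big1.
Qed.

End experiment_moments.

(** * Plug-in estimator *)

Lemma has_mean_integral_le d (T : measurableType d) (R : realType)
    (P : probability T R) (f g : T -> R) (e c : R) :
  measurable_fun setT f -> (forall x, 0 <= f x <= g x) -> has_mean P g e -> e <= c ->
  (\int[P]_x (f x)%:E <= c%:E)%E.
Proof.
move=> mf fg ge ec; have mg := has_mean_measurable ge; case: ge => _ ge.
apply: (@le_trans _ _ e%:E); last by rewrite lee_fin.
rewrite -ge; apply: ge0_le_integral => //.
- by move=> x _; rewrite lee_fin; case/andP: (fg x).
- exact/measurable_EFinP.
- exact/measurable_EFinP.
- by move=> x _; rewrite lee_fin; case/andP: (fg x).
Qed.

(** It turns a squared remainder into a power [b/2 <= 1] of the fourth power, to which the tangent
    inequality at [t ^+ 2] applies. *)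
Lemma pow4_powR_half (R : realType) (x b : R) :
  (`|x| `^ b) ^+ 2 = (x ^+ 4) `^ (b / 2).
Proof.
have -> : x ^+ 4 = (`|x| ^+ 2) `^ 2%:R.
  by rewrite powR_mulrn ?sqr_ge0// real_normK ?num_real// -exprM.
by rewrite sqr_powR// -powRrM; congr (_ `^ _); field.
Qed.

Section plugin_risk.
Local Open Scope classical_set_scope.
Context {R : realType} (K n : nat) (alpha gamma : R) (p : 'I_K -> R).
Context d (T : measurableType d) (P : probability T R).
Variable E : experiment n alpha gamma p P.
Hypotheses (n0 : (0 < n)%N) (alpha01 : 0 < alpha < 1) (p_simplex : prob_simplex p).

(** From here on [kappa] is the full constant of [linear_form_rate] for one category, and no longer
    the Laplace moment bound alone. *)
Notation kappa := (1 + 4 * @laplace_moment_bound R).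
Notation t := ((alpha ^+ 2 * n%:R)^-1).

Definition deviation k w : R := zhat (fun i k => Z1 E i k w) k - p k.

Let p01 k : 0 <= p k <= 1. Proof. by case: p_simplex. Qed.
Let p1 : \sum_k p k = 1. Proof. by case: p_simplex. Qed.

Let t0 : 0 < t.
Proof. by rewrite invr_gt0 mulr_gt0 ?exprn_gt0 ?ltr0n//; case/andP: alpha01. Qed.

Let pick k (l : 'I_K) : R := (l == k)%:R.

Let deviationE k w : linear_form E (pick k) w = deviation k w.
Proof.
rewrite /linear_form (bigD1 k)//= /pick eqxx mul1r big1 ?addr0// => l /negbTE ->.
by rewrite mul0r.
Qed.

Let pick01 k l : 0 <= pick k l <= 1.
Proof. by rewrite /pick; case: eqP; rewrite lexx ler01. Qed.

Let pick_rate k : linear_form_rate n alpha (pick k) = kappa * t.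
Proof.
rewrite /linear_form_rate (bigD1 k)//= /pick eqxx expr1n big1 ?addr0 ?mulr1//.
by move=> l /negbTE ->; rewrite expr0n.
Qed.

Lemma deviation_weighted_mean_sqr (i : 'I_n) (h : 'I_K -> R) k :
  (forall l, 0 <= h l) ->
  exists2 e, has_mean P (fun w => h (X2 E i w) * deviation k w ^+ 2) e &
    e <= (\sum_l h l * p l) * (kappa * t).
Proof.
move=> h0; have [e He e_le] := linear_form_mean_sqr E n0 alpha01 p_simplex
  (pick01 k) i h0.
exists e; last by rewrite -(pick_rate k).
by apply: has_mean_eq He => w; rewrite deviationE.
Qed.

Lemma deviation_mean_sqr k :
  exists2 e, has_mean P (fun w => deviation k w ^+ 2) e & e <= kappa * t.
Proof.
have [e He e_le] := deviation_weighted_mean_sqr (Ordinal n0) k (fun=> ler01).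
exists e; first by apply: has_mean_eq He => w; rewrite mul1r.
by move: e_le; under eq_bigr do rewrite mul1r; rewrite p1 mul1r.
Qed.

Lemma deviation_mean_pow4 k :
  exists2 e, has_mean P (fun w => deviation k w ^+ 4) e & e <= 3 * (kappa * t) ^+ 2.
Proof.
have [e He e_le] := linear_form_mean_pow4 E n0 alpha01 p_simplex (pick01 k).
exists e; last by rewrite -(pick_rate k).
by apply: has_mean_eq He => w; rewrite deviationE.
Qed.

Lemma deviation_measurable k : measurable_fun setT (deviation k).
Proof.
have mX i : measurable_fun setT (fun w => (X1 E i w == k)%:R : R).
  exact: has_mean_measurable (categorical_mean (X1_law E i) (fun l => (l == k)%:R)).
apply: measurable_funB => //; apply: measurable_funM => //.
apply: measurable_sum => i; apply: measurable_funD; first exact: mX.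
by apply: measurable_funM => //; exact: measurable_funP.
Qed.

Lemma trunc02_zhat_powR_measurable g k :
  measurable_fun setT (fun w => trunc02 (zhat (fun i k => Z1 E i k w) k) `^ g).
Proof.
apply: (measurableT_comp (@measurable_powR R g)).
apply: measurable_minr => //; apply: measurable_maxr => //.
have -> : (fun w => zhat (fun i k => Z1 E i k w) k) = (fun w => deviation k w + p k).
  by apply/funext => w; rewrite subrK.
by apply: measurable_funD => //; exact: deviation_measurable.
Qed.

Notation plugin_error := (fun w => plugin gamma (fun i k => Z1 E i k w) - power_sum gamma p).

Let measurable_plugin_sqr : measurable_fun setT (fun w => plugin_error w ^+ 2).
Proof.
apply: measurable_funX; apply: measurable_funB => //.
by apply: measurable_sum => k; exact: trunc02_zhat_powR_measurable.
Qed.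

Lemma plugin_risk_lt1 : 0 < gamma < 1 ->
  (\int[P]_w (plugin_error w ^+ 2)%:E <=
    ((1 + kappa) * (K%:R ^+ 2 * t `^ gamma))%:E)%E.
Proof.
move=> /andP[g0 g1]; have g01 : 0 < gamma <= 1 by rewrite g0 ltW.
have /choice[e eP] : forall k, exists e,
    has_mean P (fun w => deviation k w ^+ 2) e /\ e <= kappa * t.
  by move=> k; have [e ? ?] := deviation_mean_sqr k; exists e.
pose G w := K%:R * \sum_(k < K) (t `^ gamma + t `^ (gamma - 1) * deviation k w ^+ 2).
apply: (@has_mean_integral_le _ _ _ _ _ G
    (K%:R * \sum_(k < K) (t `^ gamma + t `^ (gamma - 1) * e k))) => //.
- move=> w; rewrite sqr_ge0/= /G /plugin /power_sum -sumrB.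
  apply: le_trans (sqr_sum_le _) _; rewrite card_ord ler_wpM2l//.
  apply: ler_sum => k _.
  apply: le_trans (powR_interpolation g01 t0 (sqr_ge0 _)).
  rewrite -[X in X <= _]real_normK ?num_real// -[deviation k w ^+ 2]real_normK ?num_real//.
  rewrite -sqr_powR// lerXn2r ?nnegrE ?powR_ge0//.
  apply: le_trans (powR_holder g01 _ _) _ => //.
  + by case/andP: (trunc02_bounds (zhat (fun i k => Z1 E i k w) k)).
  + by case/andP: (p01 k).
  apply: ge0_ler_powR; rewrite ?nnegrE ?(ltW g0)//.
  exact: trunc02_contracts.
- apply: has_meanZ; apply: has_mean_sum => k.
  by apply: has_meanD (has_mean_cst P _) _; apply: has_meanZ; case: (eP k).
- have te k : t `^ gamma + t `^ (gamma - 1) * e k <= (1 + kappa) * t `^ gamma.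
    rewrite (@powRS _ t gamma) ?(ltW t0) ?gt_eqF// mulrDl mul1r lerD2l.
    rewrite mulrC mulrA ler_wpM2r ?powR_ge0//; exact: (eP k).2.
  apply: (@le_trans _ _ (K%:R * \sum_(k < K) ((1 + kappa) * t `^ gamma))).
    by rewrite ler_wpM2l//; apply: ler_sum.
  by rewrite sumr_const card_ord -[X in _ * X]mulr_natl; apply: eq_ler; ring.
Qed.

(** The error splits exactly into [gamma] times a linear form and the sum of the remainders [r k];
    the factors 2 come from [(x + y)^2 <= 2 x^2 + 2 y^2]. The Taylor constant is a parameter, so
    that it can be chosen from [gamma] alone. *)
Lemma plugin_risk_gt1 (C : R) : 1 < gamma ->
  (forall q y, 0 <= q <= 1 ->
    `|trunc02 y `^ gamma - q `^ gamma - gamma * q `^ (gamma - 1) * (y - q)|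
      <= C * `|y - q| `^ Num.min gamma 2) ->
  (\int[P]_w (plugin_error w ^+ 2)%:E <=
    (2 * gamma ^+ 2 * ((1 + 4 * @laplace_moment_bound R *
        \sum_k (p k `^ (gamma - 1)) ^+ 2) * t) +
     2 * C ^+ 2 * (1 + 3 * kappa ^+ 2) * (K%:R ^+ 2 * t `^ Num.min gamma 2))%:E)%E.
Proof.
move=> g1 HC; set b := Num.min gamma 2.
have b0 : 0 < b by rewrite lt_min; apply/andP; split; lra.
have b2 : b <= 2 by rewrite ge_min lexx orbT.
pose a k := p k `^ (gamma - 1).
have a01 k : 0 <= a k <= 1.
  rewrite powR_ge0/=; have /andP[p0 pk1] := p01 k.
  have := @ge0_ler_powR R (gamma - 1) ltac:(lra) (p k) 1.
  by rewrite !nnegrE powR1; apply.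
have [eL HL eL_le] := linear_form_mean_sqr E n0 alpha01 p_simplex a01 (Ordinal n0)
  (fun=> ler01).
have /choice[e eP] : forall k, exists e,
    has_mean P (fun w => deviation k w ^+ 4) e /\ e <= 3 * (kappa * t) ^+ 2.
  by move=> k; have [e ? ?] := deviation_mean_pow4 k; exists e.
pose r k w := trunc02 (zhat (fun i k => Z1 E i k w) k) `^ gamma - p k `^ gamma -
  gamma * a k * deviation k w.
have t20 : 0 < t ^+ 2 by rewrite exprn_gt0.
pose u := (t ^+ 2) `^ (b / 2); pose u' := (t ^+ 2) `^ (b / 2 - 1).
have hb : 0 < b / 2 <= 1 by lra.
have rle k w : r k w ^+ 2 <= C ^+ 2 * (u + u' * deviation k w ^+ 4).
  apply: (@le_trans _ _ (C ^+ 2 * (deviation k w ^+ 4) `^ (b / 2))).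
    rewrite -pow4_powR_half -exprMn -[leLHS]real_normK ?num_real//.
    have H : `|r k w| <= C * `|deviation k w| `^ b by exact: HC.
    by rewrite lerXn2r// nnegrE (le_trans _ H).
  rewrite ler_wpM2l ?sqr_ge0//; apply: powR_interpolation => //.
  by rewrite (exprM _ 2 2) sqr_ge0.
pose G w := 2 * gamma ^+ 2 * linear_form E a w ^+ 2 +
  2 * K%:R * \sum_(k < K) C ^+ 2 * (u + u' * deviation k w ^+ 4).
apply: (@has_mean_integral_le _ _ _ _ _ G
    (2 * gamma ^+ 2 * eL + 2 * K%:R * \sum_(k < K) C ^+ 2 * (u + u' * e k))) => //.
- move=> w; rewrite sqr_ge0/=.
  have -> : plugin gamma (fun i k => Z1 E i k w) - power_sum gamma p =
      gamma * linear_form E a w + \sum_(k < K) r k w.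
    rewrite /plugin /power_sum -sumrB /linear_form mulr_sumr -big_split/=.
    by apply: eq_bigr => k _; rewrite /r /deviation; ring.
  have := @sqr_sum_le R 'I_K (r^~ w); rewrite card_ord.
  have : \sum_(k < K) r k w ^+ 2 <= \sum_(k < K) C ^+ 2 * (u + u' * deviation k w ^+ 4).
    by apply: ler_sum => k _.
  rewrite /G; set X := \sum_(k < K) C ^+ 2 * _; set S := \sum_(k < K) r k w.
  set Y := \sum_(k < K) _; set L := linear_form _ _ _ => YX SY.
  have := ler_wpM2l (ler0n R K) YX; have := sqr_ge0 (gamma * L - S).
  rewrite -[2 * K%:R * X]mulrA -mulrA -exprMn; move: (K%:R * X) (K%:R * Y) SY => KX KY.
  by move: (gamma * L) => l; nra.
- apply: has_meanD; apply: has_meanZ.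
    by apply: has_mean_eq HL => w; rewrite mul1r.
  apply: has_mean_sum => k; apply: has_meanZ; apply: has_meanD (has_mean_cst P _) _.
  by apply: has_meanZ; case: (eP k).
have gg0 : 0 <= 2 * gamma ^+ 2 by rewrite mulr_ge0 ?sqr_ge0.
apply: lerD.
  rewrite ler_wpM2l//; move: eL_le; under eq_bigr do rewrite mul1r.
  by rewrite p1 mul1r.
have uE : u = t `^ b.
  rewrite /u -[t ^+ 2]powR_mulrn ?(ltW t0)// -powRrM; congr (_ `^ _); by field.
have u'E : u' * t ^+ 2 = u.
  by rewrite mulrC -powRS ?(ltW t20)// gt_eqF//; case/andP: hb.
have te k : u + u' * e k <= (1 + 3 * kappa ^+ 2) * t `^ b.
  rewrite mulrDl mul1r -uE lerD2l -u'E (_ : _ * (u' * _) = u' * (3 * (kappa * t) ^+ 2));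
    last by ring.
  by rewrite ler_wpM2l ?powR_ge0//; exact: (eP k).2.
apply: (@le_trans _ _ (2 * K%:R * \sum_(k < K) (C ^+ 2 * ((1 + 3 * kappa ^+ 2) * t `^ b)))).
  rewrite ler_wpM2l ?mulr_ge0//; apply: ler_sum => k _.
  by rewrite ler_wpM2l ?sqr_ge0.
by rewrite sumr_const card_ord -[X in _ * X]mulr_natl; apply: eq_ler; ring.
Qed.

End plugin_risk.

(** * Two-step estimator *)

Section independent_signs.
Context {R : realFieldType} (n : nat) (z F : R) (mu : 'I_n -> R).
Hypothesis z0 : z != 0.

Let q i (b : bool) := (1 + (-1) ^+ b * (mu i / z)) / 2.

Let q1 i : \sum_b q i b = 1.
Proof. by rewrite big_bool /q /= expr1 expr0; field. Qed.

Lemma sum_sign_prob : \sum_(s : {ffun 'I_n -> bool}) \prod_i q i (s i) = 1.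
Proof. by rewrite -bigA_distr_bigA big1. Qed.

(** A bias-variance decomposition: under [q i] the release has mean [mu i] and variance
    [z ^+ 2 - mu i ^+ 2], and the releases are uncorrelated. *)
Lemma sign_mean_sqr :
  \sum_(s : {ffun 'I_n -> bool})
     (n%:R^-1 * (\sum_i (-1) ^+ s i * z) - F) ^+ 2 * \prod_i q i (s i)
  = n%:R^-1 ^+ 2 * (\sum_i (z ^+ 2 - mu i ^+ 2)) + (n%:R^-1 * (\sum_i mu i) - F) ^+ 2.
Proof.
(* The centered release; [D1] makes the cross terms vanish and [D2] is the variance. *)
pose D i (b : bool) := (-1) ^+ b * z - mu i.
have D1 i : \sum_b q i b * D i b = 0.
  by rewrite big_bool /q /D /= expr1 expr0; field.
have D2 i : \sum_b q i b * D i b ^+ 2 = z ^+ 2 - mu i ^+ 2.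
  by rewrite big_bool /q /D /= expr1 expr0; field.
have DD i j : \sum_(s : {ffun 'I_n -> bool}) D i (s i) * D j (s j) * \prod_t q t (s t) =
    (i == j)%:R * (z ^+ 2 - mu i ^+ 2).
  transitivity (\sum_(s : {ffun 'I_n -> bool})
      \prod_t (q t (s t) * D t (s t) ^+ ((t == i) + (t == j)))).
    apply: eq_bigr => s _; rewrite [RHS]big_split/= [LHS]mulrC; congr (_ * _).
    by under [RHS]eq_bigr do rewrite exprD; rewrite big_split/= !prod_pow_eq.
  rewrite -(bigA_distr_bigA (fun t b => q t b * D t b ^+ ((t == i) + (t == j)))).
  rewrite (bigD1 i)//= eqxx; have [<-|ij] := eqVneq i j.
    rewrite D2 big1 ?mulr1 ?mul1r// => t /negbTE ->.
    by under eq_bigr do rewrite expr0 mulr1; exact: q1.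
  by rewrite D1 !mul0r.
have D0 i : \sum_(s : {ffun 'I_n -> bool}) D i (s i) * \prod_t q t (s t) = 0.
  transitivity (\sum_(s : {ffun 'I_n -> bool})
      \prod_t (q t (s t) * D t (s t) ^+ (t == i))).
    apply: eq_bigr => s _; rewrite [RHS]big_split/= [LHS]mulrC; congr (_ * _).
    by rewrite prod_pow_eq.
  rewrite -(bigA_distr_bigA (fun t b => q t b * D t b ^+ (t == i))).
  by rewrite (bigD1 i)//= eqxx D1 mul0r.
set N := n%:R^-1; pose B := N * (\sum_i mu i) - F.
transitivity (N ^+ 2 * (\sum_i \sum_j \sum_(s : {ffun 'I_n -> bool})
      D i (s i) * D j (s j) * \prod_t q t (s t)) +
    2 * B * N * (\sum_i \sum_(s : {ffun 'I_n -> bool}) D i (s i) * \prod_t q t (s t)) +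
    B ^+ 2 * \sum_(s : {ffun 'I_n -> bool}) \prod_t q t (s t)).
  have -> : \sum_i \sum_j \sum_(s : {ffun 'I_n -> bool})
        D i (s i) * D j (s j) * \prod_t q t (s t) =
      \sum_(s : {ffun 'I_n -> bool}) (\sum_i D i (s i)) ^+ 2 * \prod_t q t (s t).
    transitivity (\sum_i \sum_(s : {ffun 'I_n -> bool}) \sum_j
        D i (s i) * D j (s j) * \prod_t q t (s t)).
      by apply: eq_bigr => i _; rewrite exchange_big.
    rewrite exchange_big/=; apply: eq_bigr => s _.
    by rewrite expr2 big_distrlr mulr_suml; apply: eq_bigr => i _; rewrite mulr_suml.
  rewrite [in X in _ + X + _]exchange_big/=.
  rewrite !mulr_sumr -!big_split/=; apply: eq_bigr => s _.
  have -> : N * (\sum_i (-1) ^+ s i * z) - F = N * (\sum_i D i (s i)) + B.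
    by rewrite /D sumrB /B; ring.
  by rewrite -mulr_suml; ring.
under eq_bigr => i _ do under eq_bigr => j _ do rewrite DD.
rewrite [X in 2 * B * N * X]big1 => [|i _]; last exact: D0.
rewrite mulr0 addr0 sum_sign_prob mulr1; congr (_ * _ + _).
apply: eq_bigr => i _; rewrite (bigD1 i)//= eqxx mul1r big1 ?addr0// => j.
by rewrite eq_sym => /negbTE ->; rewrite mul0r.
Qed.

End independent_signs.

Section two_step_risk.
Local Open Scope classical_set_scope.
Context {R : realType} (K n : nat) (alpha gamma : R) (p : 'I_K -> R).
Context d (T : measurableType d) (P : probability T R).
Variable E : experiment n alpha gamma p P.
Hypotheses (n0 : (0 < n)%N) (alpha01 : 0 < alpha < 1) (p_simplex : prob_simplex p).
Hypothesis gamma1 : 1 < gamma.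

Notation kappa := (1 + 4 * @laplace_moment_bound R).
Notation t := ((alpha ^+ 2 * n%:R)^-1).
Notation z := (z_level alpha gamma).
Notation F := (power_sum gamma p).

Let f i w := first_step gamma (fun j k => Z1 E j k w) (X2 E i w).

Let alpha0 : 0 < alpha. Proof. by case/andP: alpha01. Qed.

Let expR1 : 0 < expR alpha - 1 :> R.
Proof. by rewrite subr_gt0 expR_gt1. Qed.

Let z_gt0 : 0 < z.
Proof. by rewrite mulr_gt0 ?powR_gt0// divr_gt0// addr_gt0// expR_gt0. Qed.

(** The ratio is [1 + 2 / (exp alpha - 1)], at most [1 + 2 / alpha] and so at most [3 / alpha], as
    [alpha < 1]. Its square is the source of the constant 9 in the risk bound. *)
Let z_le : z <= 2 `^ (gamma - 1) * (3 / alpha).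
Proof.
rewrite ler_wpM2l ?powR_ge0// ler_pdivrMr// mulrC mulrA ler_pdivlMr//.
have := expR_ge1Dx alpha; have /andP[? ?] := alpha01; nra.
Qed.

Let f_measurable i : measurable_fun setT (f i).
Proof.
have -> : f i = (fun w => \sum_k (X2 E i w == k)%:R *
    trunc02 (zhat (fun j k => Z1 E j k w) k) `^ (gamma - 1)).
  apply/funext => w; rewrite (bigD1 (X2 E i w))//= eqxx mul1r big1 ?addr0// => k.
  by rewrite eq_sym => /negbTE ->; rewrite mul0r.
apply: measurable_sum => k; apply: measurable_funM.
  exact: has_mean_measurable (categorical_mean (X2_law E i) (fun l => (l == k)%:R)).
exact: trunc02_zhat_powR_measurable.
Qed.

Let f_bound i w : `|f i w| <= 2 `^ (gamma - 1).
Proof.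
have /andP[y0 y2] := trunc02_bounds (zhat (fun j k => Z1 E j k w) (X2 E i w)).
by rewrite ger0_norm ?powR_ge0// ge0_ler_powR ?nnegrE ?subr_ge0 ?(ltW gamma1).
Qed.

Let signs (s : {ffun 'I_n -> bool}) : set T :=
  [set w | forall i, Z2 E i w = (-1) ^+ s i * z].

Let signs_measurable s : measurable (signs s).
Proof.
have -> : signs s = \bigcap_(i in setT) (Z2 E i @^-1` [set (-1) ^+ s i * z]).
  by apply/seteqP; split => w /= Hw i; [move=> _; exact: Hw|exact: (Hw i I)].
apply: fin_bigcap_measurable => [|i _]; first exact: finite_finset.
by rewrite -[X in measurable X]setTI; apply: measurable_funP.
Qed.

Let q w (s : {ffun 'I_n -> bool}) : R :=
  \prod_i release_prob alpha gamma (fun j k => Z1 E j k w) (X2 E i w) (s i).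

Let signs_mean s : has_mean P (q^~ s) (fine (P (signs s))).
Proof.
have [e He] : exists e, has_mean P (q^~ s) e.
  apply: (@has_mean_bounded _ _ _ _ _ ((1 + 2 `^ (gamma - 1) / z) ^+ n)) => [|w].
    apply: measurable_prod => i _; apply: measurable_funM => //.
    apply: measurable_funD => //; apply: measurable_funM => //.
    by apply: measurable_funM => //; exact: f_measurable.
  rewrite normr_prod -[X in _ ^+ X]card_ord -prodr_const; apply: ler_prod => i _.
  rewrite normr_ge0/= normrM [X in _ * X]ger0_norm// ler_pdivrMr//.
  apply: le_trans (ler_normD _ _) _; rewrite normr1 normrM normrX normrN1 expr1n mul1r.
  rewrite normrM normfV (gtr0_norm z_gt0).
  have : `|first_step gamma (fun j k => Z1 E j k w) (X2 E i w)| / z <= 2 `^ (gamma - 1) / z.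
    by rewrite ler_pM2r ?invr_gt0//; exact: f_bound.
  have : 0 <= `|first_step gamma (fun j k => Z1 E j k w) (X2 E i w)| / z.
    by rewrite divr_ge0// ltW.
  lra.
suff -> : fine (P (signs s)) = e by [].
have := @Z2_conditional_law _ _ _ _ _ _ _ _ _ E gamma1 setT s.
rewrite setTI => ->; first by rewrite He.2.
by move=> M [[M0 MC MU] _]; rewrite -(setD0 setT); exact: MC.
Qed.

(** The release probabilities sum to 1 for each outcome. This is what forces the releases to take
    only the values [z] and [- z], almost surely. *)
Let sum_signs_prob : \sum_(s : {ffun 'I_n -> bool}) fine (P (signs s)) = 1.
Proof.
apply: (has_mean_unique (has_mean_sum signs_mean)).
apply: has_mean_eq (has_mean_cst P 1) => w.
exact: esym (sum_sign_prob (fun i => f i w) (lt0r_neq0 z_gt0)).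
Qed.

Notation risk := (\int[P]_w (((two_step (fun i => Z2 E i w) - F) ^+ 2)%:E))%E.

(* Off a null set the releases take the values [(-1) ^+ s i * z], so the risk is
   a finite sum; only the conditional law on the whole space is needed. *)
Let risk_signs : risk = (\sum_(s : {ffun 'I_n -> bool})
    (n%:R^-1 * (\sum_i (-1) ^+ s i * z) - F) ^+ 2 * fine (P (signs s)))%:E.
Proof.
have signs_disj w s s' : signs s w -> signs s' w -> s = s'.
  move=> Hs Hs'; apply/ffunP => i; have := Hs i; rewrite (Hs' i).
  case: (s i); case: (s' i) => //=; rewrite ?expr1 ?expr0 ?mul1r ?mulN1r => zz;
    by have := z_gt0; lra.
pose V := \bigcup_(s in setT) signs s.
have mV : measurable V.
  by apply: fin_bigcup_measurable => [|s _]; [exact: finite_finset|].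
have VE w : \1_V w = \sum_(s : {ffun 'I_n -> bool}) \1_(signs s) w :> R.
  rewrite indicE; case: (pselect (V w)) => [Vw|nVw].
    case: (Vw) => s _ sw; rewrite mem_set// (bigD1 s)//= indicE mem_set// big1 ?addr0//.
    move=> s' /eqP s's; rewrite indicE memNset// => s'w; apply: s's.
    exact: signs_disj s'w sw.
  rewrite memNset// big1// => s _; rewrite indicE memNset// => sw; apply: nVw.
  by exists s.
have PV : P V = 1%E.
  have [_ H] : has_mean P \1_V 1.
    rewrite -sum_signs_prob; apply: has_mean_eq (fun w => esym (VE w)) _.
    by apply: has_mean_sum => s; exact: has_mean_indic.
  by rewrite -H integral_indic// setIT.
pose g (s : {ffun 'I_n -> bool}) := (n%:R^-1 * (\sum_i (-1) ^+ s i * z) - F) ^+ 2.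
have [_ <-] : has_mean P (fun w => \sum_(s : {ffun 'I_n -> bool}) g s * \1_(signs s) w)
    (\sum_(s : {ffun 'I_n -> bool}) g s * fine (P (signs s))).
  by apply: has_mean_sum => s; apply: has_meanZ; exact: has_mean_indic.
apply: ae_eq_integral => //.
- apply/measurable_EFinP; apply: measurable_funX; apply: measurable_funB => //.
  apply: measurable_funM => //; apply: measurable_sum => i; exact: measurable_funP.
- apply/measurable_EFinP; apply: measurable_sum => s; apply: measurable_funM => //.
exists (~` V); split; first exact: measurableC.
  by have := probability_setC P mV; rewrite PV subee//.
move=> w /= Hw Vw; apply: Hw => _; case: Vw => s _ sw; congr (_%:E).
rewrite (bigD1 s)//= indicE mem_set// mulr1 big1 ?addr0 => [|s' /eqP s's].
  rewrite /g /two_step; congr ((_ * _ - _) ^+ 2).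
  by apply: eq_bigr => i _; exact: sw.
rewrite indicE memNset ?mulr0// => s'w; apply: s's; exact: signs_disj s'w sw.
Qed.

(** Writing the probabilities of the sign vectors as means of [q] allows the bias-variance identity
    to be applied for each outcome. The variance is at most [z ^+ 2 / n]; the squared bias splits
    into the error of the first step and the fluctuation of the second sample around [F]. *)
Lemma two_step_risk (C : R) : 0 <= C ->
  (forall a b, 0 <= a <= 2 -> 0 <= b <= 2 ->
    `|a `^ (gamma - 1) - b `^ (gamma - 1)| <= C * `|a - b| `^ Num.min (gamma - 1) 1) ->
  t <= 1 ->
  (risk <= ((9 * (2 `^ (gamma - 1)) ^+ 2 + 2 + 2 * C ^+ 2 * (1 + kappa)) *
              t `^ Num.min (gamma - 1) 1)%:E)%E.
Proof.
move=> C0 HC t1; set eta := Num.min (gamma - 1) 1.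
have p01 k : 0 <= p k <= 1 by case: p_simplex.
have p1 : \sum_k p k = 1 by case: p_simplex.
have eta01 : 0 < eta <= 1 by rewrite lt_min subr_gt0 gamma1 ltr01 ge_min lexx orbT.
have nR0 : 0 < n%:R :> R by rewrite ltr0n.
have t0 : 0 < t by rewrite invr_gt0 mulr_gt0// exprn_gt0.
have nt : n%:R^-1 <= t.
  rewrite invfM ler_peMl ?invr_ge0 ?(ltW nR0)//.
  by rewrite invf_ge1 ?exprn_gt0// expr_le1 ?(ltW alpha0)// ltW//; case/andP: alpha01.
(* Terms of order [t] and [n^-1] are absorbed in the slower rate [t ^ eta]. *)
have tt : t <= t `^ eta by apply: ge0_powR_le1 => //; rewrite t1 ltW.
pose h k := p k `^ (gamma - 1).
have h01 k : 0 <= h k <= 1.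
  rewrite powR_ge0/=; have /andP[p0 pk1] := p01 k.
  have := @ge0_ler_powR R (gamma - 1) _ (p k) 1.
  by rewrite !nnegrE powR1 subr_ge0; apply => //; exact: ltW.
have hF : \sum_k h k * p k = F.
  apply: eq_bigr => k _; rewrite mulrC -powRS//; first by case/andP: (p01 k).
  by rewrite gt_eqF// (lt_trans ltr01).
have [e He e_le] := second_sample_mean_sqr E n0 p_simplex h01.
have /choice[e' e'P] : forall ik : 'I_n * 'I_K, exists e,
    has_mean P (fun w => (X2 E ik.1 w == ik.2)%:R * deviation E ik.2 w ^+ 2) e /\
    e <= p ik.2 * (kappa * t).
  move=> [i k]/=; have [e'' H'' le''] := deviation_weighted_mean_sqr E n0 alpha01 p_simplex
    i k (fun l => ler0n R (l == k)).
  exists e''; split => //; rewrite (le_trans le'')//.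
  by under eq_bigr do rewrite mulrC; rewrite (bigD1 k)//= eqxx mulr1 big1 ?addr0// => l
    /negbTE ->; rewrite mulr0.
(* The deviation in [f i] is taken at the random category [X2 E i]. Summing over all categories
   against indicators turns this into weights independent of the deviations, of means [p k], which
   sum to 1. *)
pose D i w := \sum_k (t `^ eta * (X2 E i w == k)%:R +
  t `^ (eta - 1) * ((X2 E i w == k)%:R * deviation E k w ^+ 2)).
have fh i w : (f i w - h (X2 E i w)) ^+ 2 <= C ^+ 2 * D i w.
  rewrite /D (bigD1 (X2 E i w))//= eqxx mulr1 mul1r [X in _ * (_ + X)]big1 => [|k]; last first.
    by rewrite eq_sym => /negbTE ->; rewrite mul0r !mulr0 addr0.
  rewrite addr0; set k := X2 E i w.
  apply: (@le_trans _ _ (C ^+ 2 * (deviation E k w ^+ 2) `^ eta)); last first.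
    rewrite ler_wpM2l ?sqr_ge0//; apply: powR_interpolation => //; exact: sqr_ge0.
  have pk02 : 0 <= p k <= 2 by have /andP[? ?] := p01 k; lra.
  have H : `|f i w - h k| <= C * `|deviation E k w| `^ eta.
    apply: le_trans (HC _ _ (trunc02_bounds _) pk02) _.
    rewrite ler_wpM2l// ge0_ler_powR ?nnegrE//; first by case/andP: eta01 => /ltW.
    exact: trunc02_contracts.
  rewrite -[X in X `^ eta]real_normK ?num_real// -sqr_powR// -exprMn.
  by rewrite -[leLHS]real_normK ?num_real// lerXn2r ?nnegrE// (le_trans _ H).
pose G w := z ^+ 2 / n%:R +
  (2 * (n%:R^-1 * \sum_(i < n) C ^+ 2 * D i w) +
   2 * (n%:R^-1 * (\sum_(i < n) h (X2 E i w)) - \sum_k h k * p k) ^+ 2).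
have HG : has_mean P G (z ^+ 2 / n%:R +
  (2 * (n%:R^-1 * \sum_(i < n) C ^+ 2 * \sum_k (t `^ eta * p k +
     t `^ (eta - 1) * e' (i, k))) + 2 * e)).
  apply: has_meanD (has_mean_cst P _) (has_meanD (has_meanZ _ (has_meanZ _ _)) (has_meanZ _ He)).
  apply: has_mean_sum => i; apply: has_meanZ; apply: has_mean_sum => k.
  apply: has_meanD; apply: has_meanZ; last by case: (e'P (i, k)).
  have := categorical_mean (X2_law E i) (fun l => (l == k)%:R).
  by rewrite (bigD1 k)//= eqxx mul1r big1 ?addr0// => l /negbTE ->; rewrite mul0r.
rewrite risk_signs lee_fin.
have HS := has_mean_sum (fun s : {ffun 'I_n -> bool} => has_meanZ
  ((n%:R^-1 * (\sum_i (-1) ^+ s i * z) - F) ^+ 2) (signs_mean s)).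
apply: le_trans (has_mean_le HS HG _) _ => [w|].
  rewrite (sign_mean_sqr F (fun i => f i w) (lt0r_neq0 z_gt0)) /G; apply: lerD.
    have -> : z ^+ 2 / n%:R = n%:R^-1 ^+ 2 * \sum_(i < n) z ^+ 2.
      by rewrite sumr_const card_ord -[X in _ = _ * X]mulr_natl; field; rewrite gt_eqF.
    rewrite ler_wpM2l ?sqr_ge0//.
    by apply: ler_sum => i _; rewrite gerBl sqr_ge0.
  set A := n%:R^-1 * (\sum_(i < n) h (X2 E i w)) - _.
  pose B := n%:R^-1 * \sum_(i < n) (f i w - h (X2 E i w)).
  have -> : n%:R^-1 * (\sum_i f i w) - F = B + A.
    by rewrite /B /A hF sumrB; ring.
  have BD : B ^+ 2 <= n%:R^-1 * \sum_(i < n) C ^+ 2 * D i w.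
    have := @sqr_sum_le R 'I_n (fun i => f i w - h (X2 E i w)); rewrite card_ord => S.
    rewrite /B exprMn; apply: le_trans (ler_wpM2l (sqr_ge0 _) S) _.
    rewrite expr2 mulrA mulfVK ?gt_eqF// ler_wpM2l ?invr_ge0 ?ler0n//.
    by apply: ler_sum => i _.
  by have := sqr_ge0 (B - A); nra.
set A := 9 * _; set B := 2 * C ^+ 2 * _.
have -> : (A + 2 + B) * t `^ eta = A * t `^ eta + (B * t `^ eta + 2 * t `^ eta) by ring.
apply: lerD.
  apply: (@le_trans _ _ ((2 `^ (gamma - 1) * (3 / alpha)) ^+ 2 / n%:R)).
    by rewrite ler_wpM2r ?invr_ge0 ?ler0n// lerXn2r ?nnegrE ?(ltW z_gt0)// (le_trans (ltW z_gt0)).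
  apply: le_trans (ler_wpM2l _ tt); last by rewrite mulr_ge0 ?sqr_ge0.
  rewrite /A; move: (2 `^ (gamma - 1)) => c.
  by apply: eq_ler; field; rewrite !gt_eqF.
apply: lerD; last by rewrite ler_wpM2l// (le_trans e_le)// (le_trans nt).
have -> : B * t `^ eta = 2 * (C ^+ 2 * ((1 + kappa) * t `^ eta)) by rewrite /B; ring.
rewrite ler_wpM2l// ler_pdivrMl//.
have te i : \sum_k (t `^ eta * p k + t `^ (eta - 1) * e' (i, k)) <= (1 + kappa) * t `^ eta.
  have -> : (1 + kappa) * t `^ eta = \sum_k (t `^ eta * p k + t `^ (eta - 1) * (p k * (kappa * t))).
    rewrite big_split/= -!mulr_sumr -mulr_suml p1 mul1r mulr1 mulrDl mul1r; congr (_ + _).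
    rewrite (@powRS _ t eta) ?(ltW t0) ?gt_eqF//; last by case/andP: eta01.
    by ring.
  apply: ler_sum => k _; rewrite lerD2l ler_wpM2l ?powR_ge0//.
  exact: (e'P (i, k)).2.
apply: (@le_trans _ _ (\sum_(i < n) C ^+ 2 * ((1 + kappa) * t `^ eta))).
  by apply: ler_sum => i _; rewrite ler_wpM2l ?sqr_ge0 ?te.
by rewrite sumr_const card_ord [leRHS]mulr_natl.
Qed.

End two_step_risk.

(** * Combined estimator *)

Section combined_risk.
Context {R : realType}.
Notation kappa := (1 + 4 * @laplace_moment_bound R).

Let kappa1 : 1 <= kappa.
Proof. by rewrite lerDl mulr_ge0// (le_trans _ laplace_moment_bound_ge1). Qed.

Lemma powR_inv (x s : R) : 0 <= x -> x^-1 `^ s = (x `^ s)^-1.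
Proof. by move=> x0; rewrite -powR_inv1// -powRrM mulN1r powRN. Qed.

Lemma sqr_powR_mul (x s : R) : (x `^ s) ^+ 2 = x `^ (2 * s).
Proof. by rewrite -powR_mulrn ?powR_ge0// -powRrM mulrC. Qed.

Lemma sup_risk_le K n alpha gamma c (r : R) :
  (forall (p : 'I_K -> R) d (T : measurableType d) (P : probability T R)
     (E : experiment n alpha gamma p P), prob_simplex p ->
     (\int[P]_w (((combined c alpha gamma (fun i k => Z1 E i k w)
        (fun i => Z2 E i w) - power_sum gamma p) ^+ 2)%:E) <= r%:E)%E) ->
  (sup_risk K n alpha gamma c <= r%:E)%E.
Proof.
move=> H; apply: ge_ereal_sup => _ [p ps [d [T [P [E ->]]]]].
by rewrite /quadratic_risk expectation.unlock; exact: H.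
Qed.

Lemma ler_sqrt_sqr (k : nat) (m : R) : 0 <= m ->
  (k%:R <= Num.sqrt m) = (k%:R ^+ 2 <= m).
Proof. by move=> m0; rewrite -{2}(sqr_sqrtr m0) ler_sqr ?nnegrE ?sqrtr_ge0. Qed.

Section regimes.
Variables (K n : nat) (alpha c gamma : R).
Hypotheses (K0 : (0 < K)%N) (n0 : (0 < n)%N) (alpha01 : 0 < alpha < 1).
Notation m := (alpha ^+ 2 * n%:R).
Hypotheses (m1 : 1 <= m) (c1 : 1 <= c).

Let m0 : 0 < m. Proof. exact: lt_le_trans m1. Qed.

Lemma combined_small z z2 : K%:R ^+ 2 <= m ->
  @combined R K n c alpha gamma z z2 = plugin gamma z.
Proof. by move=> Km; rewrite /combined ler_sqrt_sqr ?Km// ltW. Qed.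

(** Since [c >= 1], the threshold [sqrt m / c] is at most [sqrt m < K], so the estimator vanishes;
    this is why [c] does not enter the constants. *)
Lemma combined_large_lt1 z z2 : m < K%:R ^+ 2 -> gamma < 1 ->
  @combined R K n c alpha gamma z z2 = 0.
Proof.
move=> Km g1; have Ks : Num.sqrt m < K%:R.
  by rewrite ltNge ler_sqrt_sqr -?ltNge// ltW.
rewrite /combined leNgt Ks/= g1 /thresholded /tau invf_div ifF//.
apply/negbTE; rewrite -ltNge (le_lt_trans _ Ks)// ler_pdivrMr ?(lt_le_trans ltr01)//.
by rewrite ler_peMr ?sqrtr_ge0.
Qed.

Lemma combined_large_gt1 z z2 : m < K%:R ^+ 2 -> 1 < gamma ->
  @combined R K n c alpha gamma z z2 = two_step z2.
Proof.
move=> Km g1; have Ks : Num.sqrt m < K%:R.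
  by rewrite ltNge ler_sqrt_sqr -?ltNge// ltW.
by rewrite /combined leNgt Ks/= ltNge ltW.
Qed.

(** Since [K ^ (2 (1 - gamma)) = K^2 / (K^2) ^ gamma], the minimum compares [K^2] with [m], exactly
    as the estimator does, and no factor is lost. *)
Lemma combined_risk_lt1 : 0 < gamma < 1 ->
  (sup_risk K n alpha gamma c <= ((1 + kappa) *
     Num.min (K%:R `^ (2 * (1 - gamma))) (K%:R ^+ 2 / m `^ gamma))%:E)%E.
Proof.
move=> g01; have /andP[g0 g1] := g01.
have k0 : 0 < K%:R :> R by rewrite ltr0n.
have KE : K%:R `^ (2 * (1 - gamma)) = K%:R ^+ 2 / (K%:R ^+ 2) `^ gamma.
  rewrite powRrM powR_mulrn ?(ltW k0)// powRB ?powRr1 ?sqr_ge0//.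
  by rewrite (gt_eqF (exprn_gt0 2 k0)) implybT.
have K20 : 0 < K%:R ^+ 2 :> R by rewrite exprn_gt0.
apply: sup_risk_le => p d T P E ps.
rewrite KE; have [Km|Km] := leP (K%:R ^+ 2) m.
  rewrite min_r; last first.
    by rewrite ler_wpM2l ?(ltW K20)// lef_pV2 ?posrE ?powR_gt0//
      ge0_ler_powR ?nnegrE ?sqr_ge0 ?(ltW m0) ?(ltW g0).
  under eq_integral do rewrite combined_small//.
  by rewrite -powR_inv ?(ltW m0)//; exact: plugin_risk_lt1.
rewrite min_l; last first.
  by rewrite ler_wpM2l ?(ltW K20)// lef_pV2 ?posrE ?powR_gt0//
    ge0_ler_powR ?nnegrE ?sqr_ge0 ?(ltW m0) ?(ltW g0)// ltW.
under eq_integral do rewrite combined_large_lt1// sub0r sqrrN.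
apply: (has_mean_integral_le _ _ (has_mean_cst P (power_sum gamma p ^+ 2))) => //.
  by move=> x; rewrite sqr_ge0 lexx.
rewrite -KE; apply: (@le_trans _ _ (K%:R `^ (2 * (1 - gamma)))).
  rewrite -sqr_powR_mul lerXn2r ?nnegrE ?powR_ge0//.
    by apply: sumr_ge0 => k _; rewrite powR_ge0.
  by apply: prob_simplex_sum_powR => //; rewrite g0 ltW.
by rewrite ler_peMl ?powR_ge0//; move: kappa1; lra.
Qed.

Section above_one.
Variables (CT CH Y : R).
Hypothesis gamma1 : 1 < gamma.
Hypothesis CT_taylor : forall q y, 0 <= q <= 1 ->
    `|trunc02 y `^ gamma - q `^ gamma - gamma * q `^ (gamma - 1) * (y - q)|
      <= CT * `|y - q| `^ Num.min gamma 2.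
Hypotheses (CH0 : 0 <= CH) (CH_holder : forall a b, 0 <= a <= 2 -> 0 <= b <= 2 ->
    `|a `^ (gamma - 1) - b `^ (gamma - 1)| <= CH * `|a - b| `^ Num.min (gamma - 1) 1).
Hypothesis Y_sum : forall p : 'I_K -> R, prob_simplex p ->
  \sum_k (p k `^ (gamma - 1)) ^+ 2 <= Y.
Hypothesis Y1 : 1 <= Y.

(** A function of [gamma] and of the Taylor constant only, so that it can be fixed before [K], [n],
    [alpha] and [c]; the bound [Y], which may depend on [K], is kept in the rate. *)
Definition plugin_constant : R :=
  2 * gamma ^+ 2 * kappa + 2 * CT ^+ 2 * (1 + 3 * kappa ^+ 2).

Definition two_step_constant : R :=
  9 * (2 `^ (gamma - 1)) ^+ 2 + 2 + 2 * CH ^+ 2 * (1 + kappa).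

Let sqr2_ge0 (x : R) : 0 <= 2 * x ^+ 2.
Proof. by rewrite mulr_ge0// sqr_ge0. Qed.

Let kappa_ge0 : 0 <= kappa. Proof. exact: le_trans ler01 kappa1. Qed.

Let kappa3_ge0 : 0 <= 1 + 3 * kappa ^+ 2.
Proof. by rewrite addr_ge0// mulr_ge0// sqr_ge0. Qed.

Lemma plugin_constant_ge0 : 0 <= plugin_constant.
Proof. by apply: addr_ge0; apply: mulr_ge0. Qed.

Lemma two_step_constant_ge0 : 0 <= two_step_constant.
Proof.
apply: addr_ge0; last by apply: mulr_ge0 => //; rewrite addr_ge0.
by rewrite addr_ge0// mulr_ge0// sqr_ge0.
Qed.

Lemma combined_risk_small : K%:R ^+ 2 <= m ->
  (sup_risk K n alpha gamma c <=
    (plugin_constant * (K%:R ^+ 2 / m `^ Num.min gamma 2 + Y / m))%:E)%E.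
Proof.
move=> Km; apply: sup_risk_le => p d T P E ps.
under eq_integral do rewrite combined_small//.
apply: le_trans (plugin_risk_gt1 E n0 alpha01 ps gamma1 CT_taylor) _.
rewrite lee_fin powR_inv ?(ltW m0)//; set A := K%:R ^+ 2 / _.
have A0 : 0 <= A by rewrite divr_ge0 ?powR_ge0 ?sqr_ge0.
have S_le : (1 + 4 * @laplace_moment_bound R * \sum_k (p k `^ (gamma - 1)) ^+ 2) / m
    <= kappa * (Y / m).
  rewrite mulrA ler_pM2r ?invr_gt0//.
  have L0 : 0 <= 4 * @laplace_moment_bound R by move: kappa1; rewrite lerDl.
  by have := ler_wpM2l L0 (Y_sum ps); move: Y1; lra.
have Ym0 : 0 <= Y / m by rewrite divr_ge0 ?(ltW m0)// (le_trans ler01).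
rewrite /plugin_constant; set c2 := 2 * CT ^+ 2 * _.
have c20 : 0 <= c2 by apply: mulr_ge0.
have c10 := sqr2_ge0 gamma.
have := ler_wpM2l c10 S_le.
have := mulr_ge0 (mulr_ge0 c10 kappa_ge0) A0; have := mulr_ge0 c20 Ym0.
move: (2 * gamma ^+ 2) kappa (Y / m) (_ / m) => g k y x; lra.
Qed.

Lemma combined_risk_large : m < K%:R ^+ 2 ->
  (sup_risk K n alpha gamma c <=
    (two_step_constant * (1 / m `^ Num.min (gamma - 1) 1))%:E)%E.
Proof.
move=> Km; apply: sup_risk_le => p d T P E ps.
under eq_integral do rewrite combined_large_gt1//.
rewrite mul1r -powR_inv ?(ltW m0)//; apply: two_step_risk => //.
by rewrite invf_le1.
Qed.

End above_one.
End regimes.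

(** [Y] is [K ^ (3 - 2 gamma)] or 1, according to the position of [gamma] relative to 3/2. Each
    regime bounds the risk by one member of the minimum, which is then compared with the other. For
    [K ^+ 2 <= m] this uses the upper bound on [Y]: [Y K / m <= m ^ (2 - gamma) / m = 1 / m ^ (gamma
    - 1)]. *)
Lemma combined_risk_12 (gamma : R) (Y : nat -> R) : 1 < gamma < 2 ->
  (forall K (p : 'I_K -> R), (0 < K)%N -> prob_simplex p ->
     \sum_k (p k `^ (gamma - 1)) ^+ 2 <= Y K) ->
  (forall K, (0 < K)%N -> 1 <= Y K <= (K%:R ^+ 2) `^ (2 - gamma)) ->
  sup_risk_lesssim gamma (fun K n alpha =>
    Num.min (1 / (alpha ^+ 2 * n%:R) `^ (gamma - 1))
      (K%:R ^+ 2 / (alpha ^+ 2 * n%:R) `^ gamma + Y K / (alpha ^+ 2 * n%:R))).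
Proof.
move=> /andP[g1 g2] YS Y1.
have [CT _ HT] := trunc02_powR_taylor g1.
have [|CH CH0 HH] := @powR_min_holder R (gamma - 1); first by rewrite subr_gt0.
have A0 := plugin_constant_ge0 gamma CT; have B0 := two_step_constant_ge0 gamma CH.
exists (2 * plugin_constant gamma CT + two_step_constant gamma CH).
move=> K n alpha c K0 n0 alpha01 m1 c1; set m := alpha ^+ 2 * n%:R in m1 *.
have m0 : 0 < m by exact: lt_le_trans m1.
have /andP[YK1 YK2] := Y1 K K0; have YS' p := YS K p K0.
have K2 : 0 <= K%:R ^+ 2 :> R by exact: sqr_ge0.
have mg1 : m `^ gamma = m * m `^ (gamma - 1).
  by rewrite powRS ?(ltW m0)// gt_eqF// (lt_trans ltr01).
have mg2 : m `^ (2 - gamma) / m = 1 / m `^ (gamma - 1).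
  have -> : 2 - gamma = 1 - (gamma - 1) by ring.
  rewrite powRB ?(gt_eqF m0) ?implybT// powRr1 ?(ltW m0)//.
  by field; rewrite !gt_eqF// powR_gt0.
set X := 1 / m `^ (gamma - 1); set Z := K%:R ^+ 2 / _ + _.
have X0 : 0 <= X by rewrite divr_ge0 ?powR_ge0.
have Ym0 : 0 <= Y K / m by rewrite divr_ge0 ?(ltW m0)// (le_trans ler01).
have Z0 : 0 <= Z by apply: addr_ge0 => //; apply: divr_ge0 => //; exact: powR_ge0.
have gmin : Num.min gamma 2 = gamma by rewrite min_l ?ltW.
have gmin' : Num.min (gamma - 1) 1 = gamma - 1 by rewrite min_l//; lra.
have [Km|Km] := leP (K%:R ^+ 2) m.
  have := combined_risk_small c n0 alpha01 m1 g1 HT YS' YK1 Km.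
  rewrite gmin -/m -/Z => /le_trans; apply; rewrite lee_fin.
  have ZX : Z <= 2 * X.
    rewrite mulr_natl mulr2n; apply: lerD.
      rewrite /X mg1 invfM mulrA ler_wpM2r ?invr_ge0 ?powR_ge0//.
      by rewrite ler_pdivrMr ?mul1r.
    rewrite /X -mg2 ler_wpM2r ?invr_ge0 ?(ltW m0)// (le_trans YK2)//.
    by rewrite ge0_ler_powR ?nnegrE ?(ltW m0)//; lra.
  have W0 : 0 <= Num.min X Z by rewrite le_min X0 Z0.
  have ZW : Z <= 2 * Num.min X Z.
    by rewrite /Num.min; case: ifP => _ //; rewrite ler_peMl//; lra.
  have := ler_wpM2l A0 ZW; have := mulr_ge0 B0 W0; lra.
have := combined_risk_large c n0 alpha01 m1 g1 CH0 HH Km.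
rewrite gmin' -/m -/X => /le_trans; apply; rewrite lee_fin.
have XZ : X <= Z.
  rewrite ler_wpDr// /X mg1 invfM mulrA ler_wpM2r ?invr_ge0 ?powR_ge0//.
  by rewrite ler_pdivlMr ?mul1r// ltW.
rewrite min_l// ler_wpM2r// lerDr mulr_ge0//.
Qed.

(** Both smoothness exponents saturate, at 2 and 1. The two-step bound is then [1/m], and the
    plug-in remainder [K^2 / m^2] is at most [1/m] where it is used. *)
Lemma combined_risk_ge2 (gamma : R) : 2 <= gamma ->
  sup_risk_lesssim gamma (fun K n alpha => 1 / (alpha ^+ 2 * n%:R)).
Proof.
move=> g2; have g1 : 1 < gamma by lra.
have [CT _ HT] := trunc02_powR_taylor g1.
have [|CH CH0 HH] := @powR_min_holder R (gamma - 1); first by rewrite subr_gt0.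
have A0 := plugin_constant_ge0 gamma CT; have B0 := two_step_constant_ge0 gamma CH.
exists (2 * plugin_constant gamma CT + two_step_constant gamma CH).
move=> K n alpha c K0 n0 alpha01 m1 c1; set m := alpha ^+ 2 * n%:R in m1 *.
have m0 : 0 < m by exact: lt_le_trans m1.
have im0 : 0 <= 1 / m by rewrite divr_ge0 ?ltW.
have gmin : Num.min gamma 2 = 2 by rewrite min_r.
have gmin' : Num.min (gamma - 1) 1 = 1 by rewrite min_r//; lra.
have [Km|Km] := leP (K%:R ^+ 2) m.
  have YS (p : 'I_K -> R) : prob_simplex p -> \sum_k (p k `^ (gamma - 1)) ^+ 2 <= 1.
    move=> ps; under eq_bigr do rewrite sqr_powR_mul.
    by apply: prob_simplex_sum_powR_le1 => //; lra.
  have := combined_risk_small c n0 alpha01 m1 g1 HT YS (lexx 1) Km.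
  rewrite gmin -/m => /le_trans; apply; rewrite lee_fin.
  have Z : K%:R ^+ 2 / m `^ 2 <= 1 / m.
    rewrite (powR_mulrn 2) ?(ltW m0)// expr2 invfM mulrA ler_wpM2r ?invr_ge0 ?(ltW m0)//.
    by rewrite ler_pdivrMr ?mul1r.
  have := ler_wpM2l A0 Z; have := mulr_ge0 B0 im0; lra.
have := combined_risk_large c n0 alpha01 m1 g1 CH0 HH Km.
rewrite gmin' -/m powRr1 ?(ltW m0)// => /le_trans; apply; rewrite lee_fin.
by rewrite ler_wpM2r// lerDr mulr_ge0.
Qed.

End combined_risk.

Unset Implicit Arguments.

Theorem corollary2p5 (R : realType) (gamma : R) :
  [/\ 0 < gamma < 1 ->
        sup_risk_lesssim gamma (fun K n alpha =>
          Num.min (K%:R `^ (2 * (1 - gamma)))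
                  (K%:R ^+ 2 / (alpha ^+ 2 * n%:R) `^ gamma)),
      1 < gamma < 3 / 2 ->
        sup_risk_lesssim gamma (fun K n alpha =>
          Num.min (1 / (alpha ^+ 2 * n%:R) `^ (gamma - 1))
                  (K%:R ^+ 2 / (alpha ^+ 2 * n%:R) `^ gamma
                   + K%:R `^ (3 - 2 * gamma) / (alpha ^+ 2 * n%:R))),
      3 / 2 < gamma < 2 ->
        sup_risk_lesssim gamma (fun K n alpha =>
          Num.min (1 / (alpha ^+ 2 * n%:R) `^ (gamma - 1))
                  (K%:R ^+ 2 / (alpha ^+ 2 * n%:R) `^ gamma
                   + 1 / (alpha ^+ 2 * n%:R))) &
      2 <= gamma ->
        sup_risk_lesssim gamma (fun K n alpha =>
          1 / (alpha ^+ 2 * n%:R)) ].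
Proof.
have geK K s : (0 < K)%N -> 0 <= s -> 1 <= K%:R `^ s :> R.
  by move=> K0 s0; rewrite -[leLHS](powRr0 K%:R) ler_powR// ler1n.
have K2 K : (K%:R ^+ 2) `^ (2 - gamma) = K%:R `^ (2 * (2 - gamma)) :> R.
  by rewrite powRrM powR_mulrn.
split.
- move=> g01; eexists => K n alpha c K0 n0 alpha01 m1 c1.
  exact: combined_risk_lt1.
- move=> /andP[g1 g32]; apply: combined_risk_12 => [|K p K0 ps|K K0].
  + by rewrite g1/=; lra.
  (* The noise in the linear part brings the power sum of order [2 (gamma - 1)], which lies below 1
     exactly when [gamma < 3/2]; this separates the second case from the third. *)
  + under eq_bigr do rewrite sqr_powR_mul.
    have -> : 3 - 2 * gamma = 1 - 2 * (gamma - 1) by ring.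
    by apply: prob_simplex_sum_powR => //; lra.
  + by rewrite geK ?K2 ?ler_powR ?ler1n//; lra.
- move=> /andP[g32 g2]; apply: combined_risk_12 => [|K p K0 ps|K K0].
  + by rewrite g2 andbT; lra.
  + under eq_bigr do rewrite sqr_powR_mul.
    by apply: prob_simplex_sum_powR_le1 => //; lra.
  + by rewrite lexx K2 geK//; lra.
- exact: combined_risk_ge2.
Qed.
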